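(* Let $\alpha=(\alpha_1,\dots,\alpha_k)$ be a weak composition with $k\ge1$, and let $\delta\in\mathbb P$. Write $\alpha+\delta=(\alpha_1+\delta,\dots,\alpha_k+\delta)$ and $\delta^r=(\delta,\dots,\delta)$ ($r$ entries). (1) If $\alpha_k>0$, then $Z\binom{\alpha}{\alpha+\delta}=M_\alpha$. (2) If $\alpha_k=0$, then $Z\binom{\alpha}{\alpha+\delta}=\frac{1}{|\mathfrak S_\alpha|}Z\binom{\alpha}{\beta}^{\mathfrak S_\alpha}$ for an arbitrary $\beta\in\mathbb P^k$. (3) If $\alpha_k>0$, then for every integer $s\ge0$ and every $\beta\in\mathbb P^k$, $$Z\tbinom{\alpha,0^s}{\beta,\delta^s}=Z\tbinom{\alpha,0^s}{\delta^{k+s}}.$$ (4) $Z\binom{\alpha}{\alpha+\delta}=Z\binom{\alpha}{\delta^k}$.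
   Context: $\mathbb P$ denotes the positive and $\mathbb N$ the nonnegative integers. A weak composition is a finite sequence of nonnegative integers. Let $X=\{x_i:i\in\mathbb P\}$ be commuting indeterminates. For $\alpha$ with $\alpha_k>0$, $M_\alpha=\sum_{0<i_1<\cdots<i_k}x_{i_1}^{\alpha_1}\cdots x_{i_k}^{\alpha_k}$. GSym. $\mathrm{GSym}\subseteq\mathbb Q[[X]]$ is the $\mathbb Q$-span of the series $\widehat M_{\binom{\gamma}{\mu}}=\sum_{0<i_1<\cdots<i_r}i_1^{\mu_1}\cdots i_r^{\mu_r}x_{i_1}^{\gamma_1}\cdots x_{i_r}^{\gamma_r}$, for $\gamma\in\mathbb N^r$ with $r=0$ or $\gamma_r>0$, and $\mu\in\mathbb N^r$. Regularization. For $\alpha\in\mathbb N^k$ and $\beta\in\mathbb P^k$, $\phi\binom{\alpha}{\beta}\in\mathrm{GSym}[t][z^{-1},z]]$ is obtained from $$\sum_{0<i_1<\cdots<i_k}x_{i_1}^{\alpha_1}\cdots x_{i_k}^{\alpha_k}e^{(i_1+t)\beta_1z}\cdots e^{(i_k+t)\beta_kz}$$ as follows. The coefficient of each $X$-monomial converges absolutely for $t\ge0$, $\mathrm{Re}(z)<0$. It is expanded as a Laurent series in $z$ with coefficients in $\mathbb Q[t]$, and powers are collected. Renormalization. Let $P$ be the projection onto the polar part in $z$. Set $\phi_-(\emptyset)=1$. For $k\ge 1$ define $$\phi_-\tbinom{\alpha}{\beta}=-P\big(\phi\tbinom{\alpha}{\beta}+\sum_{i=1}^{k-1}\phi\tbinom{\alpha_1..\alpha_i}{\beta_1..\beta_i}\phi_-\tbinom{\alpha_{i+1}..\alpha_k}{\beta_{i+1}..\beta_k}\big),$$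 $$\phi_+\tbinom{\alpha}{\beta}=(\mathrm{id}-P)\big(\text{same expression}\big).$$ Then $Z\binom{\alpha}{\beta}:=\phi_+\binom{\alpha}{\beta}\big|_{z=0}\in\mathrm{GSym}[t]$. Symmetrization. Let $j$ be the largest index with $\alpha_j>0$ ($j=0$ if none), $m=k-j$, and $\mathfrak S_\alpha=\mathfrak S_m$ the symmetric group on $\{1,\dots,m\}$. Define $$Z\tbinom{\alpha}{\beta}^{\mathfrak S_\alpha}=\sum_{\sigma\in\mathfrak S_m}Z\tbinom{\alpha_1,\dots,\alpha_k}{\beta_1,\dots,\beta_j,\beta_{j+\sigma(1)},\dots,\beta_{j+\sigma(m)}}.$$ *)

(* Defs.v *)
From HB Require Import structures.
From mathcomp Require Import all_boot all_order all_algebra all_fingroup.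
From mathcomp Require Import all_classical all_reals.
From mathcomp Require Import topology normedtype sequences esum exp.
From mathcomp Require Import Rstruct Rstruct_topology.
From Stdlib Require Import ClassicalEpsilon.

Set Implicit Arguments.
Unset Strict Implicit.
Unset Printing Implicit Defensive.

Import Order.TTheory GRing.Theory Num.Theory.
Local Open Scope classical_set_scope.
Local Open Scope ring_scope.

Notation RR := Rdefinitions.R.

(* X-monomials.  A monomial x_1^{m_0} x_2^{m_1} ... is encoded by the        *)
(* sequence m of its exponents; the exponent of x_n (n >= 1) is             *)
(* nth 0 m n.-1, so trailing zeros are irrelevant.                          *)

(* exponent of x_n in x_{i_1}^{a_1} ... x_{i_k}^{a_k}, with i := (i_j), a := (a_j) *)
Definition expo (a i : seq nat) (n : nat) : nat :=
  (\sum_(j < size i) if nth 0 i j == n then nth 0 a j else 0)%N.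

Definition matchb (a i m : seq nat) : bool :=
  all (fun n => expo a i n == nth 0 m n.-1) (iota 1 (size m + foldr maxn 0 i)).

Definition incr (i : seq nat) : bool := path ltn 0 i.

Fixpoint allseqs (k N : nat) : seq (seq nat) :=
  match k with
  | 0 => [:: [::]]
  | k'.+1 => [seq a :: s | a <- iota 1 N, s <- allseqs k' N]
  end.

(* M_alpha (for alpha with last entry > 0): coefficient of the monomial m is
   the number of tuples 0<i_1<...<i_k with x_{i_1}^{a_1}...x_{i_k}^{a_k} = m;
   such tuples necessarily have entries <= size m. *)
Definition Mcoef (a m : seq nat) : nat :=
  count (fun i => incr i && matchb a i m) (allseqs (size a) (size m)).

(* Laurent series in z with coefficients in Q[t]:                           *)
(*   Laur N f  represents  sum_{n >= 0} f n * z^(n - N).                    *)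
Record laurent := Laur { lord : nat; lcf : nat -> {poly rat} }.

Definition lzero : laurent := Laur 0 (fun _ => 0).
Definition lone : laurent := Laur 0 (fun n => if n == 0%N then 1 else 0).
Definition lshift (L : laurent) (d n : nat) : {poly rat} :=
  if (d <= n)%N then lcf L (n - d) else 0.
Definition ladd (L1 L2 : laurent) : laurent :=
  Laur (lord L1 + lord L2) (fun n => lshift L1 (lord L2) n + lshift L2 (lord L1) n).
Definition lopp (L : laurent) : laurent := Laur (lord L) (fun n => - lcf L n).
Definition lmul (L1 L2 : laurent) : laurent :=
  Laur (lord L1 + lord L2) (fun n => \sum_(i < n.+1) lcf L1 i * lcf L2 (n - i)).
Definition lpolar (L : laurent) : laurent :=
  Laur (lord L) (fun n => if (n < lord L)%N then lcf L n else 0).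
Definition lreg (L : laurent) : laurent :=
  Laur (lord L) (fun n => if (lord L <= n)%N then lcf L n else 0).
Definition lcoef0 (L : laurent) : {poly rat} := lcf L (lord L).

Definition expands (L : laurent) (F : RR -> RR -> RR) : Prop :=
  forall t : RR, 0 <= t ->
    exists2 eps : RR, 0 < eps &
      forall z : RR, - eps < z < 0 ->
        series (fun n => (map_poly (@ratr RR) (lcf L n)).[t] * z ^+ n) @ \oo -->
          z ^+ lord L * F t z.

Definition xser := seq nat -> laurent.

Fixpoint divs (m : seq nat) : seq (seq nat) :=
  match m with
  | [::] => [:: [::]]
  | a :: m' => [seq b :: d | b <- iota 0 a.+1, d <- divs m']
  end.

Definition mdiff (m d : seq nat) : seq nat := [seq (p.1 - p.2)%N | p <- zip m d].

Definition xzero : xser := fun _ => lzero.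
Definition xone : xser := fun m => if all (fun e => e == 0%N) m then lone else lzero.
Definition xadd (F G : xser) : xser := fun m => ladd (F m) (G m).
Definition xopp (F : xser) : xser := fun m => lopp (F m).
Definition xmul (F G : xser) : xser :=
  fun m => \big[ladd/lzero]_(d <- divs m) lmul (F d) (G (mdiff m d)).
Definition xpolar (F : xser) : xser := fun m => lpolar (F m).
Definition xreg (F : xser) : xser := fun m => lreg (F m).

(* Regularization.  A word is a list of columns (alpha_j, beta_j).          *)
Definition word := seq (nat * nat).

(* coefficient of the monomial m in
   sum_{0<i_1<...<i_k} x_{i_1}^{a_1}...x_{i_k}^{a_k} e^{(i_1+t)b_1 z}...e^{(i_k+t)b_k z},
   for real t >= 0, z < 0 (all terms are positive). *)
Definition Fcoef (w : word) (m : seq nat) (t z : RR) : RR :=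
  fine (\esum_(i in [set i : seq nat | [/\ size i = size w, incr i & matchb (unzip1 w) i m]])
          (expR (z * \sum_(j < size w)
                   ((nth 0%N i j)%:R + t) * (nth 0%N (unzip2 w) j)%:R))%:E)%E.

Definition phi (w : word) : xser :=
  fun m => epsilon (inhabits lzero) (fun L => expands L (Fcoef w m)).

Definition core (phim : word -> xser) (w : word) : xser :=
  xadd (phi w)
       (\big[xadd/xzero]_(1 <= i < size w) xmul (phi (take i w)) (phim (drop i w))).

(* phi_- by recursion on the length (n is fuel, n >= size w suffices) *)
Fixpoint phim_aux (n : nat) (w : word) : xser :=
  match n with
  | 0 => xone
  | n'.+1 => if w is [::] then xone else xopp (xpolar (core (phim_aux n') w))
  end.

Definition phim (w : word) : xser := phim_aux (size w) w.

Definition phip (w : word) : xser :=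
  match w with
  | [::] => xone
  | _ => xreg (core phim w)
  end.

(* Z(alpha; beta) in GSym[t], as the function monomial |-> coefficient in Q[t] *)
Definition Zw (w : word) (m : seq nat) : {poly rat} := lcoef0 (phip w m).
Definition Zc (alpha beta : seq nat) : seq nat -> {poly rat} := Zw (zip alpha beta).

Definition ntz (alpha : seq nat) : nat := find (fun x => x != 0%N) (rev alpha).

Definition permtail (alpha beta : seq nat) (s : 'S_(ntz alpha)) : seq nat :=
  take (size alpha - ntz alpha) beta ++
  [seq nth 0%N beta (size alpha - ntz alpha + s i) | i <- enum 'I_(ntz alpha)].
Arguments permtail : clear implicits.

(* Main.v *)
Require Import Defs.
From HB Require Import structures.
From mathcomp Require Import all_boot all_order all_algebra all_fingroup.
From mathcomp Require Import all_classical all_reals.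
From mathcomp Require Import ereal topology normedtype sequences esum exp.
From mathcomp Require Import Rstruct Rstruct_topology.
From mathcomp Require Import ring lra zify.
From Stdlib Require Import ClassicalEpsilon.
From Coquelicot Require Hierarchy Series PSeries ElemFct.

(** For a word u v with v = (0^s; c) and u empty or ending in a column with
    positive first entry, only finitely many index tuples i of u contribute to a
    given X-monomial; each contributes an exponential regular in z times the zero
    word series T(c) with t replaced by t + last i.

    Counterterms of zero words do not depend on t.  Indeed, splitting off the
    terms with i_1 = 1 expresses K(t) - K(t + 1), where K is the expression whose
    polar part defines the counterterm, as an exponential times the renormalized
    series of a shorter word.  This is regular, so the polar part of K is
    polynomial in t and 1-periodic, hence constant.  Consequently the counterterms
    of zero words renormalize the factors T(c)(t + last i) simultaneously, words
    with a nonzero column have counterterm 0, and Z(uv) is the sum over i of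
    Z(0^s; c)(t + last i): it depends only on the first entries of u and on c.

    The geometric factors f(x) = e^x / (1 - e^x) satisfy
    f(x) f(y) = f(x + y) (f(x) + f(y) + 1), so T is multiplicative for the
    quasi-shuffle product of a letter with a word; so are the counterterms, because
    the defect is both polar and regular, and so is Z.  As
    Z(0; a) = - t - 1/2 for every a, the sum of Z(0^s; c) over the rearrangements
    of c depends on s alone. *)

Set Implicit Arguments.
Unset Strict Implicit.
Unset Printing Implicit Defensive.

Import Order.TTheory GRing.Theory Num.Theory.
Import numFieldNormedType.Exports.
Local Open Scope classical_set_scope.
Local Open Scope ring_scope.

(** * Sums of power series at small negative z *)

Definition near0 (P : RR -> Prop) : Prop :=
  exists2 eps : RR, 0 < eps & forall z, - eps < z < 0 -> P z.

Lemma near0W (P : RR -> Prop) : (forall z, z < 0 -> P z) -> near0 P.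
Proof. by move=> h; exists 1 => // z /andP[_ /h]. Qed.

Lemma near0S (P Q : RR -> Prop) :
  (forall z, z < 0 -> P z -> Q z) -> near0 P -> near0 Q.
Proof. by move=> PQ [e e0 h]; exists e => // z ze; apply: PQ (h _ ze); case/andP: ze. Qed.

Lemma near0I (P Q : RR -> Prop) : near0 P -> near0 Q -> near0 (fun z => P z /\ Q z).
Proof.
move=> [e e0 hP] [d d0 hQ]; exists (Num.min e d); first by rewrite lt_min e0.
move=> z /andP[h1 h2]; split; [apply: hP|apply: hQ]; rewrite h2 andbT;
  apply: le_lt_trans h1; rewrite lerN2 ge_min lexx ?orbT //.
Qed.

Lemma near0S2 (P Q S : RR -> Prop) :
  (forall z, z < 0 -> P z -> Q z -> S z) -> near0 P -> near0 Q -> near0 S.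
Proof. by move=> h hP hQ; apply: near0S (near0I hP hQ) => z z0 []; apply: h. Qed.

Lemma near0_const (P : Prop) : near0 (fun=> P) -> P.
Proof.
move=> [e e0 h]; apply: (h (- (e / 2))); apply/andP; split; lra.
Qed.

Notation is_sum := (@Series.is_series Hierarchy.R_AbsRing Hierarchy.R_NormedModule).

(** Bridge between the limits that occur in [expands] and the Coquelicot series, whose theorems on
    Cauchy products and radii of convergence are used below. *)
Lemma is_sum_cvg (u : nat -> RR) (l : RR) :
  is_sum u l <-> (series u @ \oo --> l).
Proof.
rewrite Series.is_series_Reals.
split.
- move=> h; apply/cvg_ballP => e e0.
  have [N hN] := h e (elimT RltP e0).
  (* [series] at n has n terms, while the partial sum of the standard reals at n has n + 1; hence
     the threshold is raised by one. *)
  exists N.+1 => //= -[//|n] Nn; rewrite /ball /= distrC.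
  have := hN n (elimT ssrnat.leP (ltnSE Nn)); move/RltP; rewrite RdistE sum_f_R0E.
  by rewrite /series.
- move/cvg_ballP => h e /RltP e0.
  have [N _ hN] := h e e0.
  exists N => n /ssrnat.leP Nn; apply/RltP; rewrite RdistE sum_f_R0E distrC.
  exact: (hN n.+1 (leqW Nn)).
Qed.

Lemma is_sum_scal (a : RR) (u : nat -> RR) (l : RR) :
  is_sum u l -> is_sum (fun n => a * u n) (a * l).
Proof. exact: (@Series.is_series_scal_l Hierarchy.R_AbsRing Hierarchy.R_NormedModule a u l). Qed.

Definition psum (c : nat -> RR) (h : RR -> RR) : Prop :=
  near0 (fun z => is_sum (fun n => c n * z ^+ n) (h z)).

Lemma psum_ext c h h' : psum c h -> near0 (fun z => h z = h' z) -> psum c h'.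
Proof. by apply: near0S2 => z _ + <-. Qed.

Lemma psum_extc c c' h : c =1 c' -> psum c h -> psum c' h.
Proof. by move=> /funext ->. Qed.

Lemma psumD c c' h h' : psum c h -> psum c' h' ->
  psum (fun n => c n + c' n) (fun z => h z + h' z).
Proof.
apply: near0S2 => z _ h1 h2.
have := Series.is_series_plus _ _ _ _ h1 h2.
apply: Series.is_series_ext => n.
by rewrite /Hierarchy.plus /= RplusE mulrDl.
Qed.

Lemma psumZ a c h : psum c h -> psum (fun n => a * c n) (fun z => a * h z).
Proof.
apply: near0S => z _ h1.
have := is_sum_scal (a := a) h1.
apply: Series.is_series_ext => n.
by rewrite mulrA.
Qed.

Lemma psum0 : psum (fun=> 0) (fun=> 0).
Proof.
apply: near0W => z _; apply/Series.is_series_Reals => e /RltP e0; exists 0%N => n _.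
apply/RltP; rewrite RdistE sum_f_R0E big1 ?subrr ?normr0 // => i _; exact: mul0r.
Qed.

Definition pshift (d : nat) (c : nat -> RR) (n : nat) : RR :=
  if (d <= n)%N then c (n - d)%N else 0.

(** As z < 0 is nonzero, multiplication by z can be undone; the backward direction is what allows
    powers of z to be cancelled. *)
Lemma psum_shift1 c h : psum (pshift 1 c) (fun z => z * h z) <-> psum c h.
Proof.
have E z l : z < 0 -> is_sum (fun n => c n * z ^+ n) l <->
    is_sum (fun n => pshift 1 c n * z ^+ n) (z * l).
  move=> z0; have zn0 : z != 0 by rewrite lt_eqF.
  have e0 : pshift 1 c 0 * z ^+ 0 = 0 by rewrite mul0r.
  split=> H.
  - apply: Series.is_series_decr_1.
    rewrite /Hierarchy.plus /Hierarchy.opp /= e0 !RealsE oppr0 addr0.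
    have := is_sum_scal (a := z) H; apply: Series.is_series_ext => n.
    by rewrite /pshift subn1 /= exprS mulrCA.
  - have {}H : is_sum (fun n => pshift 1 c n.+1 * z ^+ n.+1) (z * l).
      have := @Series.is_series_incr_1 Hierarchy.R_AbsRing Hierarchy.R_NormedModule
        (fun n => pshift 1 c n * z ^+ n) (z * l).
      by rewrite /Hierarchy.plus /= e0 !RealsE addr0; apply.
    move/(is_sum_scal (a := z^-1)): H; rewrite mulKf //.
    apply: Series.is_series_ext => n.
    by rewrite /pshift subn1 /= exprS mulrCA mulKf.
by split; apply: near0S => z z0 /(E z _ z0).
Qed.

Lemma pshiftS d c : pshift d.+1 c =1 pshift 1 (pshift d c).
Proof.
by case=> [|n]; rewrite /pshift //= subn1 ltnS subSS.
Qed.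

Lemma psum_shift d c h : psum (pshift d c) (fun z => z ^+ d * h z) <-> psum c h.
Proof.
elim: d h => [|d IH] h.
  split; [move=> H; apply: (psum_extc (c := pshift 0 c))|move=> H; apply: (psum_extc (c := c))] => //.
  - by move=> n; rewrite /pshift /= subn0.
  - by apply: psum_ext H _; apply: near0W => z _; rewrite mul1r.
  - by move=> n; rewrite /pshift /= subn0.
  - by apply: psum_ext H _; apply: near0W => z _; rewrite mul1r.
apply: iff_trans (IH h); rewrite -(psum_shift1 (pshift d c)).
split=> H.
- apply: (psum_extc (pshiftS d c)).
  by apply: psum_ext H _; apply: near0W => z _; rewrite exprS mulrA.
- apply: (psum_extc (fun n => esym (pshiftS d c n))).
  by apply: psum_ext H _; apply: near0W => z _; rewrite exprS mulrA.
Qed.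

Lemma is_sum_pseries (c : nat -> RR) (z l : RR) : is_sum (fun n => c n * z ^+ n) l <->
  @PSeries.is_pseries Hierarchy.R_AbsRing Hierarchy.R_NormedModule c z l.
Proof.
rewrite /PSeries.is_pseries; split; apply: Series.is_series_ext => n;
by rewrite /Hierarchy.scal /= /Hierarchy.mult /= Hierarchy.pow_n_pow RealsE RpowE mulrC.
Qed.

(** Convergence at the single point -e/2 already forces the radius to be at least e/2, since outside
    the disk the terms do not tend to 0. A one-sided hypothesis thus gives a two-sided
    neighbourhood, as needed for continuity at 0 and for products. *)
Lemma psum_radius c h : psum c h -> exists2 e : RR, 0 < e &
  forall z, `|z| < e -> Rbar.Rbar_lt (Rbar.Finite (Rbasic_fun.Rabs z)) (PSeries.CV_radius c).
Proof.
move=> [e e0 H]; exists (e / 2); first lra.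
have ze : - e < - (e / 2) < 0 by apply/andP; split; lra.
have /H /is_sum_pseries H1 := ze.
have R : Rbar.Rbar_le (Rbar.Finite (e / 2)) (PSeries.CV_radius c).
  apply: Rbar.Rbar_not_lt_le => lt.
  apply: (@PSeries.CV_disk_outside c (- (e / 2))).
    by rewrite RabsE normrN ger0_norm //; lra.
  apply: Series.ex_series_lim_0; exists (h (- (e/2))).
  move/is_sum_pseries: H1; apply: Series.is_series_ext => n.
  by rewrite !RealsE.
move=> z zlt; apply: Rbar.Rbar_lt_le_trans R.
by rewrite RabsE; apply/RltP.
Qed.

Lemma psumM c c' h h' : psum c h -> psum c' h' ->
  psum (fun n => \sum_(i < n.+1) c i * c' (n - i)%N) (fun z => h z * h' z).
Proof.
move=> H H'; have [e e0 R] := psum_radius H; have [e' e0' R'] := psum_radius H'.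
have N : near0 (fun z => `|z| < e /\ `|z| < e').
  by apply: near0I; [exists e|exists e'] => // z /andP[z1 z2]; rewrite ltr0_norm //; lra.
apply: near0S2 (near0I H H') N => z z0 [h1 h2] [z1 z2].
apply/is_sum_pseries.
move/is_sum_pseries: h1 => h1; move/is_sum_pseries: h2 => h2.
have := PSeries.is_pseries_mult _ _ _ _ _ h1 h2 (R _ z1) (R' _ z2).
apply: PSeries.is_pseries_ext => n.
by rewrite /PSeries.PS_mult sum_f_R0E big_mkord; apply: eq_bigr => i _; rewrite !RealsE.
Qed.

(** The sum is continuous at 0, where its value is [c 0], and it vanishes at negative points
    arbitrarily close to 0. *)
Lemma psum_head c : psum c (fun=> 0) -> c 0%N = 0.
Proof.
move=> H; have [e e0 R] := psum_radius H.
have C := PSeries.PSeries_continuity _ _ (R 0 _).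
have [//|c0] := eqVneq (c 0%N) 0.
(* The tolerance in the continuity statement is [|c 0|] itself, so that a nearby zero gives
   [|c 0| < |c 0|]. *)
have /RltP c0' : 0 < `|c 0%N| by rewrite normr_gt0.
have {C}[|d [/RltP d0 C]] := C _ _ c0'; first by rewrite normr0.
have nd : near0 (fun z => `|z| < d) by exists d => // z /andP[z1 z2]; rewrite ltr0_norm //; lra.
exfalso; apply: near0_const; apply: near0S2 nd H => z z0 zd /is_sum_pseries Hz.
have := C z; rewrite (PSeries.is_pseries_unique _ _ _ Hz) PSeries.PSeries_0 /=.
rewrite !RdistE sub0r normrN subr0 => H; have /RltP : Rdefinitions.Rlt `|c 0%N| `|c 0%N|.
  apply: H; split; last exact/RltP.
  by split=> //; apply/eqP; rewrite eq_sym lt_eqF.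
by rewrite ltxx.
Qed.

Lemma psum_eq0 c h : psum c h -> near0 (fun z => h z = 0) -> forall n, c n = 0.
Proof.
move=> H h0.
have {H h0} : psum c (fun=> 0) by apply: psum_ext H h0.
move=> H n; elim: n c H => [|n IH] c H; first exact: psum_head.
apply: (IH (fun n => c n.+1)); apply/psum_shift1.
apply: (psum_extc (c := c)).
  by case=> [|k] //; rewrite /pshift /= ?subn1 // psum_head.
by apply: psum_ext H _; apply: near0W => z _; rewrite mulr0.
Qed.

Lemma psum_fun_unique c h h' : psum c h -> psum c h' -> near0 (fun z => h z = h' z).
Proof.
apply: near0S2 => z _ H1 H2.
by rewrite -(Series.is_series_unique _ _ H1) (Series.is_series_unique _ _ H2).
Qed.

Lemma psum_exp (a : RR) : psum (fun n => a ^+ n / n`!%:R) (fun z => expR (a * z)).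
Proof.
apply: near0W => z _.
have /is_sum_pseries := ElemFct.is_exp_Reals (a * z).
rewrite RexpE; apply: Series.is_series_ext => n.
rewrite !RealsE exprMn; ring.
Qed.

Lemma psum_cst (a : RR) : psum (fun n => if n == 0%N then a else 0) (fun=> a).
Proof.
apply: (psum_extc (c := fun n => a * (0 ^+ n / n`!%:R))).
  by case=> [|n] /=; rewrite ?expr0n /= ?fact0 ?divr1 ?mulr1 // mul0r mulr0.
apply: psum_ext (psumZ a (psum_exp 0)) _.
by apply: near0W => z _; rewrite mul0r exp.expR0 mulr1.
Qed.

Lemma psum_scale (w : RR) c h : 0 < w -> psum c h ->
  psum (fun n => c n * w ^+ n) (fun z => h (w * z)).
Proof.
move=> w0 [e e0 H]; exists (e / w); first exact: divr_gt0.
move=> z /andP[z1 z2]; have := H (w * z).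
have -> : - e < w * z < 0.
  rewrite pmulr_rlt0 // z2 andbT.
  by move: z1; rewrite -mulNr ltr_pdivrMr // mulrC.
move/(_ isT); apply: Series.is_series_ext => n.
by rewrite exprMn mulrA.
Qed.

(** * The generating function of the Bernoulli numbers *)

(* bernl n = [:: a_n; ...; a_0], where x / (e^x - 1) = sum_n a_n x^n *)
Fixpoint bernl (n : nat) : seq rat :=
  if n is n'.+1 then
    (- \sum_(k < n) (bernl n')`_k / (k.+2)`!%:R) :: bernl n'
  else [:: 1].

(** This is B_n / n! with the convention B_1 = -1/2. *)
Definition bern (n : nat) : rat := (bernl n)`_0.

Lemma nth_bernl n k : (k <= n)%N -> (bernl n)`_k = bern (n - k).
Proof. by elim: n k => [|n IH] [|k] //= kn; rewrite IH. Qed.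

Lemma bernS n : bern n.+1 = - \sum_(k < n.+1) bern (n - k) / (k.+2)`!%:R.
Proof.
rewrite /bern /=; congr (- _); apply: eq_bigr => k _.
by rewrite nth_bernl // -ltnS.
Qed.

Lemma bern1 : bern 1 = - 2^-1.
Proof. by rewrite bernS big_ord1 /bern /= div1r. Qed.

Lemma fact_ge_expn2 k : (2 ^ k.+1 <= k.+2`!)%N.
Proof.
elim: k => // k IH; rewrite factS expnS; exact: leq_mul.
Qed.

(** In the recursion, 1/(k+2)! is at most 2^-(k+1), and these powers sum to less than 1. The crude
    bound is enough for convergence when |z| < 1. *)
Lemma bern_bound n : `|bern n| <= 1.
Proof.
have [m] := ubnP n; elim: m n => // m IH [|n] nm; first by rewrite /bern /= normr1.
rewrite bernS normrN; apply: le_trans (ler_norm_sum _ _ _) _.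
apply: (@le_trans _ _ (\sum_(k < n.+1) (2^-1) ^+ k.+1)).
  apply: ler_sum => k _; rewrite normrM.
  have h1 : `|bern (n - k)| <= 1 by apply: IH; lia.
  apply: le_trans (ler_wpM2r (normr_ge0 _) h1) _; rewrite mul1r.
  rewrite ger0_norm ?invr_ge0 ?ler0n // exprVn lef_pV2 ?posrE ?ltr0n ?fact_gt0 ?exprn_gt0 //.
  by rewrite -natrX ler_nat fact_ge_expn2.
suff -> : \sum_(k < n.+1) (2^-1 : rat) ^+ k.+1 = 1 - 2^-1 ^+ n.+1.
  by rewrite gerBl exprn_ge0.
elim: n {IH nm} => [|n IHn]; first by rewrite big_ord1 expr1.
rewrite big_ord_recr /= IHn [in RHS]exprS [in RHS]exprS [X in _ + X]exprS; set y := _ ^+ n.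
by rewrite exprS -/y; field.
Qed.

(** By [bern_bound] the series has some sum g. The recursion says that the Cauchy product with the
    series of (e^z - 1)/z is 1, so g is the reciprocal of that function. *)
Lemma psum_bern : psum (fun n => ratr (bern n)) (fun z => z / (expR z - 1)).
Proof.
have [g Hg] : exists g, psum (fun n => ratr (bern n)) g.
  exists (fun z => Series.Series (fun n => ratr (bern n) * z ^+ n)).
  exists 1 => // z /andP[z1 z2]; apply: Series.Series_correct.
  have z3 : Rdefinitions.Rlt (Rbasic_fun.Rabs `|z|) 1.
    by rewrite RabsE normr_id; apply/RltP; rewrite ltr0_norm //; lra.
  apply: (@Series.ex_series_le Hierarchy.R_AbsRing Hierarchy.R_CompleteNormedModule) (Series.ex_series_geom _ z3) => n.
  rewrite /Hierarchy.norm /= /Hierarchy.abs /= RpowE RabsE normrM normrX; apply/RleP.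
  rewrite -[X in _ <= X]mul1r; apply: ler_wpM2r; first exact: exprn_ge0.
  by rewrite -ratr_norm -(rmorph1 (@ratr RR)) ler_rat bern_bound.
have He : psum (fun n => (n.+1)`!%:R^-1) (fun z => (expR z - 1) / z).
  apply/psum_shift1.
  apply: (psum_extc (c := fun n => 1 ^+ n / n`!%:R + (if n == 0%N then -1 else 0))).
    by case=> [|n]; rewrite /pshift /= ?subn1 expr1n ?divr1 ?subrr // addr0 div1r.
  apply: psum_ext (psumD (psum_exp 1) (psum_cst (-1))) _.
  by apply: near0W => z z0; rewrite mul1r mulrC divfK // lt_eqF.
have H1 : psum (fun n => if n == 0%N then 1 else 0) (fun z => g z * ((expR z - 1) / z)).
  apply: psum_extc (psumM Hg He) => -[|n] /=.
    by rewrite big_ord1 /bern /= rmorph1 invr1 mulr1.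
  (* The last term of the Cauchy product is [bern n.+1]; reversing the order of the others turns
     them into the sum of the recursion. *)
  rewrite big_ord_recr /= subnn factS fact0 muln1 invr1 mulr1 bernS.
  rewrite rmorphN rmorph_sum /= (reindex_inj rev_ord_inj) /=.
  apply/eqP; rewrite subr_eq0; apply/eqP/eq_bigr => i _.
  rewrite rmorphM /= fmorphV /= ratr_nat subSS; congr (_ * (_ `!%:R)^-1).
  have := ltn_ord i; lia.
apply: psum_ext Hg _.
have := psum_fun_unique H1 (psum_cst 1); apply: near0S => z z0.
have ez : expR z - 1 != 0 by rewrite subr_eq0 lt_eqF // expR_lt1.
have zn : z != 0 by rewrite lt_eqF.
move=> h; transitivity (g z * ((expR z - 1) / z) * (z / (expR z - 1))).
  by field; rewrite ez zn.
by rewrite h mul1r.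
Qed.

(** * Expansions, regular and polar functions *)

Definition cf (L : laurent) (n : nat) (t : RR) : RR :=
  (map_poly (@ratr RR) (lcf L n)).[t].

Lemma expandsE L F : expands L F <->
  (forall t, 0 <= t -> psum (fun n => cf L n t) (fun z => z ^+ lord L * F t z)).
Proof.
by split=> H t t0; apply: near0S (H t t0) => z z0 /is_sum_cvg.
Qed.

Lemma expands_ext L F G : expands L F ->
  (forall t, 0 <= t -> near0 (fun z => F t z = G t z)) -> expands L G.
Proof.
move=> /expandsE H FG; apply/expandsE => t t0.
by apply: psum_ext (H t t0) _; apply: near0S (FG t t0) => z _ ->.
Qed.

Lemma cfD L1 L2 n t : cf (ladd L1 L2) n t =
  pshift (lord L2) (cf L1 ^~ t) n + pshift (lord L1) (cf L2 ^~ t) n.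
Proof.
rewrite /cf /= rmorphD hornerD /Defs.lshift /pshift; congr (_ + _); case: ifP => _;
by rewrite ?rmorph0 ?horner0.
Qed.

Lemma expandsD L1 L2 F1 F2 : expands L1 F1 -> expands L2 F2 ->
  expands (ladd L1 L2) (fun t z => F1 t z + F2 t z).
Proof.
move=> /expandsE H1 /expandsE H2; apply/expandsE => t t0.
move/psum_shift: (H1 t t0) => /(_ (lord L2)) h1.
move/psum_shift: (H2 t t0) => /(_ (lord L1)) h2.
apply: (psum_extc (fun n => esym (cfD L1 L2 n t))).
apply: psum_ext (psumD h1 h2) _; apply: near0W => z _ /=.
by rewrite exprD; ring.
Qed.

Lemma expandsN L F : expands L F -> expands (lopp L) (fun t z => - F t z).
Proof.
move=> /expandsE H; apply/expandsE => t t0.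
apply: (psum_extc (c := fun n => -1 * cf L n t)).
  by move=> n; rewrite /cf /= rmorphN hornerN mulN1r.
by apply: psum_ext (psumZ (-1) (H t t0)) _; apply: near0W => z _ /=; ring.
Qed.

Lemma expandsM L1 L2 F1 F2 : expands L1 F1 -> expands L2 F2 ->
  expands (lmul L1 L2) (fun t z => F1 t z * F2 t z).
Proof.
move=> /expandsE H1 /expandsE H2; apply/expandsE => t t0.
apply: psum_extc (psum_ext (psumM (H1 t t0) (H2 t t0)) _).
  move=> n; rewrite /cf /= rmorph_sum horner_sum.
  by apply: eq_bigr => i _; rewrite rmorphM hornerM.
by apply: near0W => z _ /=; rewrite exprD; ring.
Qed.

Lemma expands0 : expands lzero (fun _ _ => 0).
Proof.
apply/expandsE => t t0; apply: psum_extc (psum_ext psum0 _).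
  by move=> n; rewrite /cf /= rmorph0 horner0.
by apply: near0W => z _; rewrite mulr0.
Qed.

Lemma expands_sum (T : eqType) (r : seq T) (L : T -> laurent) F :
  {in r, forall i, expands (L i) (F i)} ->
  expands (\big[ladd/lzero]_(i <- r) L i) (fun t z => \sum_(i <- r) F i t z).
Proof.
elim: r => [_|a r IH H].
  rewrite big_nil; apply: expands_ext expands0 _ => t _.
  by apply: near0W => z _; rewrite big_nil.
rewrite big_cons; apply: expands_ext (expandsD (H a (mem_head _ _)) (IH _)) _.
  by move=> i ir; apply: H; rewrite inE ir orbT.
by move=> t _; apply: near0W => z _; rewrite big_cons.
Qed.

Lemma psum_fin N (c : nat -> RR) :
  psum (fun n => if (n < N)%N then c n else 0) (fun z => \sum_(n < N) c n * z ^+ n).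
Proof.
elim: N => [|N IH].
  by apply: psum_ext psum0 _; apply: near0W => z _; rewrite big_ord0.
move/psum_shift: (psum_cst (c N)) => /(_ N) H.
apply: psum_extc (psum_ext (psumD IH H) _).
  move=> n; rewrite /pshift /=; case: (ltngtP n N) => [h|h|->].
  - by rewrite ltnW ?ltnS ?(ltnW h) // addr0.
  - by rewrite subn_eq0 leqNgt h /= ltnS leqNgt h /= addr0.
  - by rewrite ltnS leqnn subnn add0r.
by apply: near0W => z _; rewrite big_ord_recr /= [_ * c N]mulrC.
Qed.

Definition polfun (L : laurent) (t z : RR) : RR :=
  (\sum_(n < lord L) cf L n t * z ^+ n) / z ^+ lord L.

Lemma expands_polar L : expands (lpolar L) (polfun L).
Proof.
apply/expandsE => t _; apply: psum_extc (psum_ext (psum_fin (lord L) (cf L ^~ t)) _).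
  by move=> n; rewrite /cf /=; case: ifP => //; rewrite rmorph0 horner0.
apply: near0W => z z0; rewrite /polfun /= mulrC divfK //.
by rewrite expf_neq0 // lt_eqF.
Qed.

Lemma expands_reg L F : expands L F ->
  expands (lreg L) (fun t z => F t z - polfun L t z).
Proof.
move=> /expandsE H; apply/expandsE => t t0.
have /expandsE/(_ t t0) H2 := expandsN (expands_polar L).
apply: psum_extc (psum_ext (psumD (H t t0) H2) _).
  move=> n; rewrite /cf /=; case: ltnP => _; rewrite ?rmorphN ?hornerN ?subrr ?rmorph0 ?horner0 //.
  by rewrite subr0.
by apply: near0W => z _ /=; ring.
Qed.

(** A nonzero polynomial has fewer roots than its size, whereas 0, ..., [size p] - 1 would all be
    roots. *)
Lemma poly_eq0 (p : {poly rat}) : (forall n : nat, p.[n%:R] = 0) -> p = 0.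
Proof.
move=> H; apply/eqP/negPn/negP => p0.
have := @max_poly_roots _ p [seq n%:R | n <- iota 0 (size p)] p0.
rewrite size_map size_iota ltnn => F; apply: notF; apply: F.
- by apply/allP => _ /mapP[n _ ->]; apply/rootP.
- by rewrite map_inj_uniq ?iota_uniq // => a b /eqP; rewrite eqr_nat => /eqP.
Qed.

Lemma map_poly_eq0 (p : {poly rat}) :
  (forall t : RR, 0 <= t -> (map_poly (@ratr RR) p).[t] = 0) -> p = 0.
Proof.
move=> H; apply: poly_eq0 => n.
have := H n%:R (ler0n _ _); rewrite -(ratr_nat RR) horner_map => /eqP.
by rewrite fmorph_eq0 => /eqP.
Qed.

Lemma expands_eq0 L F : expands L F ->
  (forall t, 0 <= t -> near0 (fun z => F t z = 0)) -> forall n, lcf L n = 0.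
Proof.
move=> /expandsE H H0 n; apply: map_poly_eq0 => t t0.
apply: (psum_eq0 (H t t0)).
by apply: near0S (H0 t t0) => z _ ->; rewrite mulr0.
Qed.

(** Two expansions of one function may be padded to different pole orders, so coefficients are
    compared after each is shifted by the order of the other. In particular the choice made by
    [epsilon] in [phi] is harmless. *)
Lemma expands_unique L L' F : expands L F -> expands L' F ->
  forall n, Defs.lshift L (lord L') n = Defs.lshift L' (lord L) n.
Proof.
move=> H H' n; apply/eqP; rewrite -subr_eq0; apply/eqP.
have := expands_eq0 (expandsD H (expandsN H')) _ n; rewrite /= {2}/Defs.lshift /=.
rewrite -/(Defs.lshift _ _ _) => <-.
  by congr (_ + _); rewrite /Defs.lshift /=; case: ifP; rewrite ?oppr0.
by move=> t _; apply: near0W => z _; rewrite subrr.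
Qed.

Definition lregular (L : laurent) := forall n, (n < lord L)%N -> lcf L n = 0.
Definition lpurepolar (L : laurent) := forall n, (lord L <= n)%N -> lcf L n = 0.

(** Regularity with constant term p, and polarity in [pol], are stated for functions, because the
    record [laurent] is not a canonical form and its operations satisfy ring identities only up to
    padding. *)
Definition regv (F : RR -> RR -> RR) (p : {poly rat}) : Prop :=
  exists L, [/\ expands L F, lregular L & lcoef0 L = p].
Definition pol (F : RR -> RR -> RR) : Prop :=
  exists2 L, expands L F & lpurepolar L.

Lemma regv_ext F G p : regv F p ->
  (forall t, 0 <= t -> near0 (fun z => F t z = G t z)) -> regv G p.
Proof. by move=> [L [H r v]] FG; exists L; split=> //; apply: expands_ext H FG. Qed.

Lemma pol_ext F G : pol F ->
  (forall t, 0 <= t -> near0 (fun z => F t z = G t z)) -> pol G.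
Proof. by move=> [L H r] FG; exists L => //; apply: expands_ext H FG. Qed.

Lemma expands_regv L F p : expands L F -> regv F p -> lregular L /\ lcoef0 L = p.
Proof.
move=> H [L' [H' r' <-]]; have E := expands_unique H H'.
split=> [n nL|].
- have := E (n + lord L')%N; rewrite /Defs.lshift leq_addl addnK => ->.
  by case: ifP => // h; apply: r'; lia.
- by have := E (lord L + lord L')%N; rewrite /Defs.lshift leq_addl addnK leq_addr addKn.
Qed.

Lemma expands_pol L F : expands L F -> pol F -> lpurepolar L.
Proof.
move=> H [L' H' r'] n nL; have := expands_unique H H' (n + lord L')%N.
rewrite /Defs.lshift leq_addl addnK => ->.
by case: ifP => // h; apply: r'; lia.
Qed.

Lemma regv_unique F p q : regv F p -> regv F q -> p = q.
Proof. by move=> [L [H _ <-]] /(expands_regv H)[_]. Qed.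

Lemma regvD F G p q : regv F p -> regv G q -> regv (fun t z => F t z + G t z) (p + q).
Proof.
move=> [L [H r <-]] [L' [H' r' <-]]; exists (ladd L L'); split; first exact: expandsD.
- move=> n /= nL; rewrite /Defs.lshift.
  case: ifP => [h|_]; [rewrite r; last by lia|]; rewrite add0r;
  by case: ifP => // h'; rewrite r' //; lia.
- by rewrite /lcoef0 /= /Defs.lshift leq_addl addnK leq_addr addKn.
Qed.

Lemma regvN F p : regv F p -> regv (fun t z => - F t z) (- p).
Proof.
move=> [L [H r <-]]; exists (lopp L); split=> //; first exact: expandsN.
by move=> n /= nL; rewrite r ?oppr0.
Qed.

Lemma regvM F G p q : regv F p -> regv G q -> regv (fun t z => F t z * G t z) (p * q).
Proof.
move=> [L [H r <-]] [L' [H' r' <-]]; exists (lmul L L'); split; first exact: expandsM.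
- move=> n /= nL; apply: big1 => i _.
  case: (ltnP i (lord L)) => h; first by rewrite r ?mul0r.
  by rewrite r' ?mulr0 //; have := ltn_ord i; lia.
- rewrite /lcoef0 /=.
  have h : (lord L < (lord L + lord L').+1)%N by lia.
  rewrite (bigD1 (Ordinal h)) //= addKn big1 ?addr0 // => i /eqP ne.
  case: (ltngtP i (lord L)) => h'; first by rewrite r ?mul0r.
    by rewrite r' ?mulr0 //; have := ltn_ord i; lia.
  by case: ne; apply: val_inj.
Qed.

Lemma regv0 : regv (fun _ _ => 0) 0.
Proof. by exists lzero; split=> //; exact: expands0. Qed.

Lemma regv_sum (T : eqType) (r : seq T) (F : T -> RR -> RR -> RR) p :
  {in r, forall i, regv (F i) (p i)} ->
  regv (fun t z => \sum_(i <- r) F i t z) (\sum_(i <- r) p i).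
Proof.
elim: r => [_|a r IH H].
  rewrite big_nil; apply: regv_ext regv0 _ => t _.
  by apply: near0W => z _; rewrite big_nil.
rewrite big_cons; apply: regv_ext (regvD (H a (mem_head _ _)) (IH _)) _.
  by move=> i ir; apply: H; rewrite inE ir orbT.
by move=> t _; apply: near0W => z _; rewrite big_cons.
Qed.

Lemma polD F G : pol F -> pol G -> pol (fun t z => F t z + G t z).
Proof.
move=> [L H r] [L' H' r']; exists (ladd L L'); first exact: expandsD.
move=> n /= nL; rewrite /Defs.lshift.
case: ifP => [h|_]; [rewrite r; last by lia|]; rewrite add0r;
by case: ifP => // h'; rewrite r' //; lia.
Qed.

Lemma polN F : pol F -> pol (fun t z => - F t z).
Proof.
move=> [L H r]; exists (lopp L); first exact: expandsN.
by move=> n /= nL; rewrite r ?oppr0.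
Qed.

(** In each term of a coefficient of nonnegative degree, at least one of the two factors has
    nonnegative degree and vanishes. Products of counterterms therefore stay polar. *)
Lemma polM F G : pol F -> pol G -> pol (fun t z => F t z * G t z).
Proof.
move=> [L H r] [L' H' r']; exists (lmul L L'); first exact: expandsM.
move=> n /= nL; apply: big1 => i _.
case: (leqP (lord L) i) => h; first by rewrite r ?mul0r.
by rewrite r' ?mulr0 //; have := ltn_ord i; lia.
Qed.

Lemma pol0 : pol (fun _ _ => 0).
Proof. by exists lzero => //; exact: expands0. Qed.

(** Each coefficient is killed by one of the two hypotheses. This is the uniqueness behind the
    decomposition into polar and regular parts, and all identities between counterterms are derived
    from it. *)
Lemma regv_pol F p : regv F p -> pol F ->
  forall t, 0 <= t -> near0 (fun z => F t z = 0).
Proof.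
move=> [L [H r _]] /(expands_pol H) q t t0.
have /expandsE/(_ t t0) Ht := H.
have Hz : psum (fun=> 0) (fun z => z ^+ lord L * F t z).
  apply: psum_extc Ht => n; rewrite /cf.
  by case: (ltnP n (lord L)) => h; rewrite ?(r n h) ?(q n h) rmorph0 horner0.
apply: near0S (psum_fun_unique Hz psum0) => z z0 /eqP.
by rewrite mulf_eq0 expf_eq0 lt_eqF // andbF => /eqP.
Qed.

(** * Translation in t; expansions of exponentials and geometric sums *)

Definition pshiftp (n : nat) (p : {poly rat}) : {poly rat} := p \Po ('X + n%:R%:P).

Definition ltrans (n : nat) (L : laurent) : laurent :=
  Laur (lord L) (fun k => pshiftp n (lcf L k)).

Lemma expands_trans n L F : expands L F ->
  expands (ltrans n L) (fun t z => F (t + n%:R) z).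
Proof.
move=> /expandsE H; apply/expandsE => t t0.
have tn : 0 <= t + n%:R by rewrite addr_ge0.
apply: psum_extc (H _ tn) => k; rewrite /cf /= /pshiftp.
by rewrite map_comp_poly horner_comp rmorphD /= map_polyX map_polyC /= hornerD hornerX hornerC ratr_nat.
Qed.

Lemma regv_trans n F p : regv F p -> regv (fun t z => F (t + n%:R) z) (pshiftp n p).
Proof.
move=> [L [H r <-]]; exists (ltrans n L); split=> //; first exact: expands_trans.
by move=> k /= kL; rewrite r // /pshiftp comp_poly0.
Qed.

Definition lexp (a b : nat) : laurent :=
  Laur 0 (fun n => (n`!%:R^-1 : rat) *: ((a%:R%:P + b%:R *: 'X) ^+ n)).

Lemma expands_exp (a b : nat) :
  expands (lexp a b) (fun t z => expR ((a%:R + b%:R * t) * z)).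
Proof.
apply/expandsE => t _; apply: psum_extc (psum_ext (psum_exp (a%:R + b%:R * t)) _).
  move=> n; rewrite /cf /= map_polyZ /= rmorphXn /= rmorphD /= map_polyZ /= map_polyX map_polyC /=.
  by rewrite hornerZ horner_exp hornerD hornerZ hornerX hornerC !ratr_nat fmorphV /= ratr_nat mulrC.
by apply: near0W => z _; rewrite expr0 mul1r.
Qed.

Lemma regv_exp (a b : nat) : regv (fun t z => expR ((a%:R + b%:R * t) * z)) 1.
Proof.
exists (lexp a b); split=> //; first exact: expands_exp.
by rewrite /lcoef0 /= fact0 invr1 scale1r expr0.
Qed.

Lemma regv1 : regv (fun _ _ => 1) 1.
Proof.
apply: regv_ext (regv_exp 0 0) _ => t _; apply: near0W => z _.
by rewrite !mul0r add0r mul0r exp.expR0.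
Qed.

(* f(x) = e^x + e^{2x} + ... for x < 0 *)
Definition geo (x : RR) : RR := expR x / (1 - expR x).

(** The coefficients come from e^x/(1 - e^x) = -(x/(e^x - 1) + x)/x at x = bz; the pole is
    simple. *)
Definition lgeo (b : nat) : laurent :=
  Laur 1 (fun n => (- (bern n * b%:R ^+ n + (if n == 1%N then b%:R else 0)) / b%:R)%:P).

Lemma expands_geo (b : nat) : (0 < b)%N -> expands (lgeo b) (fun _ z => geo (b%:R * z)).
Proof.
move=> b0; have b0' : 0 < b%:R :> RR by rewrite ltr0n.
apply/expandsE => t _.
have H1 := psum_scale b0' psum_bern.
move/psum_shift: (psum_cst b%:R) => /(_ 1%N) H2.
apply: psum_extc (psum_ext (psumZ (- b%:R^-1) (psumD H1 H2)) _).
  move=> n; rewrite /cf /= map_polyC hornerC /= rmorphM rmorphN rmorphD rmorphM rmorphXn /= fmorphV /= ratr_nat.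
  have -> : ratr (if n == 1%N then b%:R else 0) = pshift 1 (fun n => if n == 0%N then b%:R : RR else 0) n.
    by case: n => [|[|n]]; rewrite /pshift /= ?rmorph0 ?ratr_nat.
  by ring.
apply: near0W => z z0 /=; rewrite /geo expr1.
have bn : b%:R != 0 :> RR by rewrite gt_eqF.
have e1 : expR (b%:R * z) - 1 != 0 by rewrite subr_eq0 lt_eqF // expR_lt1 pmulr_rlt0.
have e2 : 1 - expR (b%:R * z) != 0 by rewrite -opprB oppr_eq0.
by field; rewrite bn e1 e2.
Qed.

(** * The coefficients of the regularized series *)

Lemma esum_geometric (K : realType) (C q : K) : 0 <= C -> 0 < q < 1 ->
  (\esum_(n in [set: nat]) (C * q ^+ n)%:E = (C / (1 - q))%:E)%E.
Proof.
move=> C0 /andP[q0 q1]; rewrite -nneseries_esumT; last first.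
  by move=> n; rewrite lee_fin mulr_ge0 // exprn_ge0 // ltW.
apply/cvg_lim => //.
have -> : (fun n => \sum_(0 <= i < n) (C * q ^+ i)%:E)%E = EFin \o series (geometric C q).
  by apply/funext => n /=; rewrite sumEFin.
apply: cvg_EFin; first by apply: nearW.
by apply: cvg_geometric_series; rewrite ger0_norm // ltW.
Qed.

(* closed form of sum_{0<i_1<...<i_m} e^{(i_1+x)b_1 z} ... e^{(i_m+x)b_m z} for z < 0 *)
Fixpoint tailsum (b : seq nat) (x z : RR) : RR :=
  if b is b0 :: b' then
    expR (x * b0%:R * z) * geo ((sumn b)%:R * z) * tailsum b' x z
  else 1.

Lemma tailsum_ge0 b x z : z < 0 -> 0 <= tailsum b x z.
Proof.
move=> z0; elim: b => [|b0 b IH] /=; first exact: ler01.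
rewrite !mulr_ge0 ?expR_ge0 //.
by rewrite invr_ge0 subr_ge0 -[leRHS]exp.expR0 ler_expR mulr_ge0_le0 // ltW.
Qed.

Lemma tailsum_trans b x n z :
  tailsum b (x + n%:R) z = expR (z * (sumn b)%:R) ^+ n * tailsum b x z.
Proof.
rewrite -expRM_natl.
elim: b => [|b0 b IH] /=; first by rewrite mulr0 mulr0 exp.expR0 mulr1.
rewrite IH natrD.
have -> : (x + n%:R) * b0%:R * z = n%:R * (z * b0%:R) + x * b0%:R * z by ring.
have -> : n%:R * (z * (b0%:R + (sumn b)%:R)) =
  n%:R * (z * b0%:R) + n%:R * (z * (sumn b)%:R) by ring.
by rewrite !exp.expRD; ring.
Qed.

Definition phase (b i : seq nat) (t z : RR) : RR :=
  expR (z * \sum_(j < size b) ((nth 0%N i j)%:R + t) * (nth 0%N b j)%:R).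

(** Induction on [b]: for a fixed first index n the inner sum is a [tailsum] at t + n, and by
    [tailsum_trans] the sum over n > n0 is geometric with ratio e^(Bz), B the sum of all letters.
    The factor [C] carries the exponential of the first index through the induction. *)
Lemma esum_tail (b : seq nat) (n0 : nat) (C t z : RR) :
  0 <= C -> z < 0 -> all (fun x => 0 < x)%N b ->
  (\esum_(i in [set i : seq nat | size i = size b /\ path ltn n0 i])
     (C * phase b i t z)%:E = (C * tailsum b (t + n0%:R) z)%:E)%E.
Proof.
move=> + z0; elim: b n0 C => [|b0 b IH] n0 C C0 /=.
  move=> _; have -> : [set i : seq nat | size i = 0%N /\ path ltn n0 i] = [set [::]].
    by apply/seteqP; split=> i /=; [case: i => //= ? ? [] | move=> ->].
  by rewrite esum_set1 /phase big_ord0 mulr0 exp.expR0 // lee_fin mulr1.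
move=> /andP[b0p bp].
pose P := [set n | (n0 < n)%N].
pose J n := [set i : seq nat | size i = size b /\ path ltn n i].
have bij : set_bij (P `*`` J)
    [set i : seq nat | size i = (size b).+1 /\ path ltn n0 i] (fun p => p.1 :: p.2).
  split.
  - by move=> [n i] /= [Pn [si pi]]; split; [rewrite si | apply/andP].
  - by move=> [n i] [n' i'] _ _ /= [-> ->].
  - move=> [|n i] /= [// [si] /andP[h1 h2]]; by exists (n, i).
rewrite (reindex_esum _ _ _ _ bij).
have E (p : nat * seq nat) : C * phase (b0 :: b) (p.1 :: p.2) t z =
    C * expR (z * ((p.1%:R + t) * b0%:R)) * phase b p.2 t z.
  rewrite /phase /= big_ord_recl /= mulrDr exp.expRD -[RHS]mulrA.
  by [].
rewrite (eq_esum (b := fun p => (C * expR (z * ((p.1%:R + t) * b0%:R)) * phase b p.2 t z)%:E)); last first.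
  by move=> p _; rewrite E.
rewrite -(@esum_esum _ _ _ P J (fun n i => (C * expR (z * ((n%:R + t) * b0%:R)) * phase b i t z)%:E)); last first.
  by move=> n i _ _; rewrite lee_fin !mulr_ge0 ?expR_ge0.
under eq_esum => n _ do rewrite IH ?mulr_ge0 ?expR_ge0 //.
have bij2 : set_bij [set: nat] P (fun n => (n0.+1 + n)%N).
  split.
  - by move=> n _; rewrite /P /= addSn ltnS leq_addr.
  - by move=> n n' _ _ /addnI.
  - by move=> n; rewrite /P /= => h; exists (n - n0.+1)%N => //; rewrite subnKC.
rewrite (reindex_esum _ _ _ _ bij2).
set B := (sumn (b0 :: b))%:R : RR.
have B0 : 0 < B by rewrite ltr0n /= addn_gt0 b0p.
have q1 : expR (B * z) < 1 by rewrite expR_lt1 pmulr_rlt0.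
rewrite (eq_esum (b := fun n => ((C * expR ((n0%:R + 1 + t) * b0%:R * z) *
    tailsum b (t + (n0.+1)%:R) z) * expR (B * z) ^+ n)%:E)); last first.
  move=> n _; congr (_%:E); rewrite natrD addrA tailsum_trans /=.
  have -> : z * ((n0.+1%:R + n%:R + t) * b0%:R) = (n0%:R + 1 + t) * b0%:R * z + n%:R * (b0%:R * z).
    by rewrite -natr1; ring.
  have -> : B * z = b0%:R * z + (sumn b)%:R * z by rewrite /B /= natrD; ring.
  by rewrite !exp.expRD (expRM_natl n) exprMn [z * (sumn b)%:R]mulrC; ring.
rewrite esum_geometric ?expR_gt0 ?q1 //; last first.
  by rewrite !mulr_ge0 ?expR_ge0 ?tailsum_ge0.
congr (_%:E); rewrite -/B /geo -natr1 addrA (tailsum_trans _ _ 1) expr1.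
have -> : (n0%:R + 1 + t) * b0%:R * z = (t + n0%:R) * b0%:R * z + b0%:R * z by ring.
have -> : B * z = b0%:R * z + z * (sumn b)%:R by rewrite /B /= natrD; ring.
by rewrite !exp.expRD; ring.
Qed.

(** * Matching of monomials and finiteness of prefixes *)

Lemma nth_le_maxn i j : (nth 0%N i j <= foldr maxn 0%N i)%N.
Proof.
elim: i j => [|x i IH] [|j] //=; first exact: leq_maxl.
by rewrite leq_max IH orbT.
Qed.

(** [matchb] tests finitely many variables; beyond its bound both exponents are 0. *)
Lemma matchbP a i m : reflect (forall n, (0 < n)%N -> expo a i n = nth 0%N m n.-1)
  (matchb a i m).
Proof.
apply: (iffP allP) => [H n n0|H n]; last first.
  by rewrite mem_iota => /andP[n0 _]; apply/eqP/H.
case: (ltnP n (1 + (size m + foldr maxn 0%N i))) => h.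
  by apply/eqP/H; rewrite mem_iota n0.
rewrite nth_default; last by lia.
rewrite /expo big1 // => j _; case: eqP => // E.
by have := nth_le_maxn i j; lia.
Qed.

Lemma expo_cat a c i i' n : size i = size a -> all (fun x => x == 0%N) c ->
  expo (a ++ c) (i ++ i') n = expo a i n.
Proof.
move=> si /all_nthP c0; rewrite /expo.
rewrite -(big_mkord predT (fun j => if nth 0%N (i ++ i') j == n then nth 0%N (a ++ c) j else 0%N)).
rewrite -(big_mkord predT (fun j => if nth 0%N i j == n then nth 0%N a j else 0%N)).
rewrite size_cat (big_cat_nat (n := size i)) ?leq_addr //= [X in (_ + X)%N]big1_seq ?addn0.
  apply: eq_big_nat => j /andP[_ ji]; by rewrite !nth_cat -si ji.
move=> j /andP[_]; rewrite mem_index_iota => /andP[ij _].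
rewrite [nth _ (a ++ c) _]nth_cat -si ltnNge ij /=.
case: (ltnP (j - size i) (size c)) => h; last by rewrite [nth 0%N c _]nth_default ?if_same.
by rewrite (eqP (c0 0%N _ h)) if_same.
Qed.

Lemma matchb_cat a c i i' m : size i = size a -> all (fun x => x == 0%N) c ->
  matchb (a ++ c) (i ++ i') m = matchb a i m.
Proof.
move=> si c0; apply/matchbP/matchbP => H n n0; have := H n n0;
by rewrite expo_cat.
Qed.

Lemma mem_allseqs k N i :
  (i \in allseqs k N) = (size i == k) && all (fun x => 0 < x <= N)%N i.
Proof.
elim: k i => [|k IH] [|x i] //=.
- by apply/negbTE/allpairsP => -[[? ?] []].
- apply/allpairsP/idP => [[[y j] /= [hy hj [-> ->]]]|].
    by move: hj hy; rewrite IH mem_iota eqSS add1n ltnS => /andP[-> ->] ->.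
  rewrite eqSS => /and3P[sk xN al]; exists (x, i); split=> //=.
    by rewrite mem_iota add1n ltnS.
  by rewrite IH sk al.
Qed.

Lemma uniq_allseqs k N : uniq (allseqs k N).
Proof.
elim: k => //= k IH; apply: allpairs_uniq; rewrite ?iota_uniq //.
by move=> [x i] [y j] _ _ /= [-> ->].
Qed.

Definition prefixes (a m : seq nat) : seq (seq nat) :=
  [seq i <- allseqs (size a) (size m) | incr i && matchb a i m].

Lemma path_ltn_last n i x : path ltn n i -> x \in i -> (n < x <= last n i)%N.
Proof.
elim: i n => [|y i IH] n //= /andP[ny py]; rewrite inE => /orP[/eqP->|xi].
  rewrite ny /=; case: i py {IH} => //= w i /andP[yw pw].
  have : last w i \in w :: i by exact: mem_last.
  move=> /(allP (order_path_min ltn_trans (_ : path ltn y (w :: i)))) H.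
  by apply: ltnW; apply: H; rewrite /= yw.
by have /andP[h1 h2] := IH y py xi; rewrite h2 andbT (ltn_trans ny).
Qed.

(** The last exponent is positive, so the variable with index [last 0 i] occurs in [m]; this bounds
    all entries by [size m], and the finite enumeration misses nothing. The default 1 in [last 1 a]
    admits the empty word. *)
Lemma mem_prefixes a m i : (0 < last 1 a)%N ->
  (i \in prefixes a m) = [&& size i == size a, incr i & matchb a i m].
Proof.
move=> al; rewrite mem_filter mem_allseqs andbC -andbA; case: eqP => //= si.
case: (boolP (incr i && matchb a i m)) => [/andP[ii mi]|_]; last by rewrite andbF.
rewrite andbT; apply/allP => x xi.
have /andP[x0 xl] := path_ltn_last ii xi; rewrite x0 /=.
have l0 := leq_trans x0 xl; apply: leq_trans xl _.
have /matchbP/(_ _ l0) := mi.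
case: (ltnP (last 0%N i).-1 (size m)) => [h _|h]; first by rewrite -(prednK l0).
rewrite (nth_default _ h).
have i0 : (0 < size i)%N by case: i xi {si ii mi l0 h}.
have a0 : (0 < last 0%N a)%N by move: i0 al; rewrite si; case: a {si mi}.
have j0 : ((size i).-1 < size i)%N by rewrite prednK.
rewrite /expo (bigD1 (Ordinal j0)) //= nth_last eqxx.
have -> : nth 0%N a (size i).-1 = last 0%N a by rewrite si nth_last.
by lia.
Qed.

Lemma size_prefix a m i : i \in prefixes a m -> size i = size a.
Proof. by rewrite mem_filter mem_allseqs => /andP[_ /andP[/eqP]]. Qed.

Lemma phase_cat b b' i i' t z : size i = size b ->
  phase (b ++ b') (i ++ i') t z = phase b i t z * phase b' i' t z.
Proof.
move=> si; rewrite /phase size_cat big_split_ord mulrDr exp.expRD /=.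
congr (expR (_ * _) * expR (_ * _)); apply: eq_bigr => j _; rewrite !nth_cat si.
  by rewrite ltn_ord.
by rewrite ltnNge leq_addr addKn.
Qed.

(** The columns of [v] contribute no variable, so the monomial constrains only the indices of [u].
    Those of [v] run freely above [last 0 i], and [esum_tail] sums them. *)
Lemma Fcoef_cat (u v : word) m (t z : RR) : z < 0 ->
  (0 < last 1 (unzip1 u))%N -> all (fun x => x == 0%N) (unzip1 v) ->
  all (fun x => 0 < x)%N (unzip2 v) ->
  Fcoef (u ++ v) m t z =
  \sum_(i <- prefixes (unzip1 u) m)
    phase (unzip2 u) i t z * tailsum (unzip2 v) (t + (last 0%N i)%:R) z.
Proof.
move=> z0 ul v0 vp; rewrite /Fcoef.
pose P := [set` prefixes (unzip1 u) m].
pose J (i : seq nat) := [set i' : seq nat | size i' = size (unzip2 v) /\ path ltn (last 0%N i) i'].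
have bij : set_bij (P `*`` J) [set i : seq nat |
    [/\ size i = size (u ++ v), incr i & matchb (unzip1 (u ++ v)) i m]] (fun p => p.1 ++ p.2).
  split.
  - move=> [i i'] /= [Pi [si' pi']].
    have si := size_prefix Pi.
    move: Pi; rewrite /P /= mem_prefixes // => /and3P[_ ii mi]; split.
    + by rewrite !size_cat si si' !size_map.
    + by rewrite /incr cat_path; apply/andP.
    + by rewrite /unzip1 map_cat matchb_cat.
  - move=> [i i'] [j j'] /set_mem /= [Pi _] /set_mem /= [Pj _] /eqP.
    by rewrite eqseq_cat ?(size_prefix Pi) ?(size_prefix Pj) // => /andP[/eqP-> /eqP->].
  - move=> i /= [si ii mi]; exists (take (size u) i, drop (size u) i); last by rewrite /= cat_take_drop.
    have st : size (take (size u) i) = size u by rewrite size_takel // si size_cat leq_addr.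
    move: ii mi; rewrite -{1 2}(cat_take_drop (size u) i) /incr cat_path /unzip1 map_cat => /andP[i1 i2].
    rewrite matchb_cat //; last by rewrite st size_map.
    move=> mi; rewrite /P /J /=; split.
      by rewrite mem_prefixes // st size_map eqxx /incr i1 mi.
    by split=> //; rewrite size_drop si size_cat addKn size_map.
rewrite (reindex_esum _ _ _ _ bij).
rewrite (eq_esum (b := fun p => (phase (unzip2 u) p.1 t z * phase (unzip2 v) p.2 t z)%:E)); last first.
  move=> [i i'] /= [Pi _]; rewrite -phase_cat; last by rewrite (size_prefix Pi) !size_map.
  by rewrite /phase /unzip2 -map_cat size_map.
rewrite -(@esum_esum _ _ _ P J (fun i i' => (phase (unzip2 u) i t z * phase (unzip2 v) i' t z)%:E)); last first.
  by move=> i i' _ _; rewrite lee_fin mulr_ge0 ?expR_ge0.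
under eq_esum => i _ do rewrite esum_tail ?expR_ge0 //.
rewrite esum_fset; last 2 first.
- exact: finite_seq.
- by move=> i _; rewrite lee_fin mulr_ge0 ?expR_ge0 ?tailsum_ge0.
rewrite -fsbig_seq ?sumEFin //=.
by rewrite filter_uniq // uniq_allseqs.
Qed.

Lemma all_zero_prefixes m :
  prefixes [::] m = if all (fun e => e == 0%N) m then [:: [::]] else [::].
Proof.
rewrite /prefixes /=; suff -> : matchb [::] [::] m = all (fun e => e == 0%N) m by [].
apply/matchbP/(all_nthP 0%N) => [H i im|H n n0].
  by rewrite -(H i.+1) // /expo big_ord0.
rewrite /expo big_ord0; case: (ltnP n.-1 (size m)) => h; last by rewrite nth_default.
by rewrite (eqP (H _ h)).
Qed.

(** * Counterterms *)

Lemma ex_expands_sum (T : eqType) (r : seq T) (F : T -> RR -> RR -> RR) :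
  {in r, forall i, exists L, expands L (F i)} ->
  exists L, expands L (fun t z => \sum_(i <- r) F i t z).
Proof.
elim: r => [_|a r IH H].
  by exists lzero; apply: expands_ext expands0 _ => t _; apply: near0W => z _; rewrite big_nil.
have [L HL] := H a (mem_head _ _).
have [|L' HL'] := IH; first by move=> i ir; apply: H; rewrite inE ir orbT.
exists (ladd L L'); apply: expands_ext (expandsD HL HL') _ => t _.
by apply: near0W => z _; rewrite big_cons.
Qed.

Lemma regv_phase b i : regv (phase b i) 1.
Proof.
apply: regv_ext (regv_exp (\sum_(j < size b) nth 0%N i j * nth 0%N b j) (\sum_(j < size b) nth 0%N b j)) _.
move=> t _; apply: near0W => z _; rewrite /phase mulrC; congr (expR (_ * _)).
rewrite !natr_sum mulr_suml -big_split /=; apply: eq_bigr => j _.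
by rewrite natrM; ring.
Qed.

Lemma ex_expands_tailsum b : all (fun x => 0 < x)%N b -> exists L, expands L (tailsum b).
Proof.
elim: b => [_|b0 b IH /= /andP[b0p /IH[L HL]]].
  by have [L [H _ _]] := regv1; exists L.
have H1 := expands_exp 0 b0.
have H2 : expands (lgeo (b0 + sumn b)) (fun _ z => geo ((b0 + sumn b)%:R * z)).
  by apply: expands_geo; rewrite addn_gt0 b0p.
exists (lmul (lmul (lexp 0 b0) (lgeo (b0 + sumn b))) L).
apply: expands_ext (expandsM (expandsM H1 H2) HL) _ => t _.
by apply: near0W => z _; rewrite add0r [b0%:R * t]mulrC.
Qed.

Lemma word_split (w : word) : exists u v : word, [/\ w = u ++ v,
  (0 < last 1 (unzip1 u))%N & all (fun x => x == 0%N) (unzip1 v)].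
Proof.
elim/last_ind: w => [|w x [u [v [-> ul v0]]]]; first by exists [::], [::].
have [x0|x0] := eqVneq x.1 0%N.
  exists u, (rcons v x); split=> //; first by rewrite -rcons_cat.
  by rewrite /unzip1 map_rcons all_rcons x0 eqxx.
exists (rcons (u ++ v) x), [::]; split=> //; first by rewrite cats0.
by rewrite /unzip1 map_rcons last_rcons lt0n.
Qed.

Definition posword (w : word) : bool := all (fun x => 0 < x)%N (unzip2 w).

Lemma posword_cat u v : posword (u ++ v) = posword u && posword v.
Proof. by rewrite /posword /unzip2 map_cat all_cat. Qed.

Lemma posword_take i w : posword w -> posword (take i w).
Proof. by rewrite -{1}(cat_take_drop i w) posword_cat => /andP[]. Qed.

Lemma posword_drop i w : posword w -> posword (drop i w).
Proof. by rewrite -{1}(cat_take_drop i w) posword_cat => /andP[]. Qed.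

(** [phi] picks an expansion by choice; one exists because [Fcoef_cat] writes the coefficient as a
    finite sum of products of expandable functions. *)
Lemma expands_phi w m : posword w -> expands (phi w m) (Fcoef w m).
Proof.
move=> wp; apply: (epsilon_spec (inhabits lzero) (fun L => expands L (Fcoef w m))).
have [u [v [E ul v0]]] := word_split w.
have vp : posword v by move: wp; rewrite E posword_cat => /andP[].
have [|L HL] := @ex_expands_sum _ (prefixes (unzip1 u) m)
    (fun i t z => phase (unzip2 u) i t z * tailsum (unzip2 v) (t + (last 0%N i)%:R) z).
  move=> i _; have [L [H _ _]] := regv_phase (unzip2 u) i.
  have [L' H'] := ex_expands_tailsum vp.
  exists (lmul L (ltrans (last 0%N i) L')).
  exact: expandsM H (expands_trans _ H').
exists L; apply: expands_ext HL _ => t _; apply: near0W => z z0.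
by rewrite E Fcoef_cat.
Qed.

Lemma xadd_sum (r : seq nat) (F : nat -> xser) m :
  (\big[xadd/xzero]_(i <- r) F i) m = \big[ladd/lzero]_(i <- r) F i m.
Proof. by elim: r => [|a r IH]; rewrite ?big_nil ?big_cons // /xadd IH. Qed.

(** The functions [C] standing for the counterterms are a parameter: first those of zero words,
    later [ctw] for all words. *)
Definition corefun (C : word -> seq nat -> RR -> RR -> RR) (w : word) (m : seq nat) (t z : RR) : RR :=
  Fcoef w m t z + \sum_(1 <= i < size w) \sum_(d <- divs m)
    Fcoef (take i w) d t z * C (drop i w) (mdiff m d) t z.

Lemma expands_core (C : word -> seq nat -> RR -> RR -> RR) w m : posword w ->
  (forall i d, (0 < i < size w)%N -> d \in divs m ->
     expands (phim (drop i w) (mdiff m d)) (C (drop i w) (mdiff m d))) ->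
  expands (core phim w m) (corefun C w m).
Proof.
move=> wp H; apply: expandsD; first exact: expands_phi.
rewrite xadd_sum; apply: expands_sum => i; rewrite mem_index_iota => iw.
apply: expands_sum => d dm; apply: expandsM; last exact: H.
by apply: expands_phi; apply: posword_take.
Qed.

Lemma phim_aux_fuel n n' w : (size w <= n)%N -> (size w <= n')%N ->
  phim_aux n w = phim_aux n' w.
Proof.
elim: n n' w => [|n IH] [|n'] [|x w] //= wn wn'; congr (xopp (xpolar _)).
rewrite /core; congr xadd; apply: eq_big_nat => i /andP[i0 iw].
by congr xmul; apply: IH; rewrite size_drop /=; move: wn wn' i0 iw => /=; lia.
Qed.

Lemma phimE w : w <> [::] -> phim w = xopp (xpolar (core phim w)).
Proof.
case: w => // x w _; rewrite /phim /=; congr (xopp (xpolar _)).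
rewrite /core; congr xadd; apply: eq_big_nat => i /andP[i0 iw].
by congr xmul; apply: phim_aux_fuel; rewrite size_drop /=; move: i0 iw => /=; lia.
Qed.

Lemma phipE w : w <> [::] -> phip w = xreg (core phim w).
Proof. by case: w. Qed.

Lemma lpolar_opp_polar L : lpolar (lopp (lpolar L)) = lopp (lpolar L).
Proof.
by rewrite /lpolar /lopp /=; congr Laur; apply/funext => n; case: (n < lord L)%N; rewrite ?oppr0.
Qed.

Lemma polfun_opp_polar L t z : polfun (lopp (lpolar L)) t z = - polfun L t z.
Proof.
rewrite /polfun /= -mulNr -sumrN; congr (_ / _); apply: eq_bigr => n _.
by rewrite /cf /= ltn_ord rmorphN hornerN mulNr.
Qed.

Lemma expands_phim w m : w <> [::] -> expands (phim w m) (fun t z => - polfun (core phim w m) t z).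
Proof.
move=> wn; rewrite (phimE wn) /xopp /xpolar; rewrite -[X in expands X]lpolar_opp_polar.
apply: expands_ext (expands_polar _) _ => t _; apply: near0W => z _.
by rewrite polfun_opp_polar.
Qed.

Lemma regv_reg L F : expands L F -> regv (fun t z => F t z - polfun L t z) (lcoef0 L).
Proof.
move=> /expands_reg H; exists (lreg L); split=> //; last by rewrite /lcoef0 /= leqnn.
by move=> n /= nL; rewrite leqNgt nL.
Qed.

Lemma Zw_core w m : w <> [::] -> Zw w m = lcoef0 (core phim w m).
Proof. by move=> wn; rewrite /Zw phipE // /lcoef0 /xreg /= leqnn. Qed.

(** * Counterterms of zero words *)

Definition zeroword (b : seq nat) : word := [seq (0%N, x) | x <- b].

Lemma unzip1_zeroword b : all (fun x => x == 0%N) (unzip1 (zeroword b)).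
Proof. by elim: b. Qed.

Lemma unzip2_zeroword b : unzip2 (zeroword b) = b.
Proof. by elim: b => //= x b ->. Qed.

(* The value at t = 0 is used because the counterterm does not depend on t. *)
Definition ctm (b : seq nat) (z : RR) : RR :=
  if b is [::] then 1 else - polfun (core phim (zeroword b) [::]) 0 z.

Definition renorm (b : seq nat) (t z : RR) : RR :=
  \sum_(0 <= i < (size b).+1) tailsum (take i b) t z * ctm (drop i b) z.

(** For nonempty [b] this is the function that [core] represents: the unrenormalized series is the
    term i = [size b], and the missing term i = 0 is the counterterm to be defined. *)
Definition prenorm (b : seq nat) (t z : RR) : RR :=
  \sum_(1 <= i < (size b).+1) tailsum (take i b) t z * ctm (drop i b) z.

Lemma renormE b t z : renorm b t z = ctm b z + prenorm b t z.
Proof. by rewrite /renorm big_ltn // take0 drop0 /= mul1r. Qed.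

Lemma Fcoef_zeroword b t z : z < 0 -> all (fun x => 0 < x)%N b ->
  Fcoef (zeroword b) [::] t z = tailsum b t z.
Proof.
move=> z0 bp; rewrite -[zeroword b]cat0s Fcoef_cat ?unzip1_zeroword ?unzip2_zeroword //.
by rewrite big_seq1 /= addr0 /phase big_ord0 mulr0 exp.expR0 mul1r.
Qed.

(** Replacing t by t + 1 amounts to requiring i_1 > 1, so the difference collects the terms with i_1
    = 1, where the other indices start at 2. *)
Lemma tailsum_diff b0 b t z : z < 0 -> (0 < b0)%N ->
  tailsum (b0 :: b) t z - tailsum (b0 :: b) (t + 1) z =
  expR ((b0%:R + b0%:R * t) * z) * tailsum b (t + 1) z.
Proof.
move=> z0 b0p; rewrite !(tailsum_trans _ _ 1) !expr1 /= /geo.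
set B := (b0 + sumn b)%:R.
have B0 : 0 < B :> RR by rewrite ltr0n addn_gt0 b0p.
have e1 : 1 - expR (B * z) != 0.
  by rewrite subr_eq0 eq_sym lt_eqF // expR_lt1 pmulr_rlt0.
have -> : (b0%:R + b0%:R * t) * z = t * b0%:R * z + b0%:R * z by ring.
move: e1; have -> : B * z = b0%:R * z + z * (sumn b)%:R by rewrite /B natrD; ring.
have -> : z * B = b0%:R * z + z * (sumn b)%:R by rewrite /B natrD; ring.
by rewrite !exp.expRD => e1; field.
Qed.

Lemma prenorm_cons b0 b t z : prenorm (b0 :: b) t z =
  \sum_(0 <= i < (size b).+1) tailsum (b0 :: take i b) t z * ctm (drop i b) z.
Proof. by rewrite /prenorm /= big_add1. Qed.

(** Every prefix in [prenorm] begins with [b0], so [tailsum_diff] applies term by term. The result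
    is regular as soon as the series of the shorter word is. *)
Lemma prenorm_diff b0 b t z : z < 0 -> (0 < b0)%N ->
  prenorm (b0 :: b) t z - prenorm (b0 :: b) (t + 1) z =
  expR ((b0%:R + b0%:R * t) * z) * renorm b (t + 1) z.
Proof.
move=> z0 b0p; rewrite !prenorm_cons -sumrB /renorm mulr_sumr; apply: eq_bigr => i _.
by rewrite -mulrBl tailsum_diff // mulrA.
Qed.

Lemma pshiftp_fix p : p - pshiftp 1 p = 0 -> p = (p.[0])%:P.
Proof.
move=> /eqP; rewrite subr_eq0 => /eqP E; apply/eqP; rewrite -subr_eq0; apply/eqP.
apply: poly_eq0; elim=> [|n IH]; first by rewrite !hornerE subrr.
move: IH; rewrite {1}E /pshiftp !hornerE horner_comp !hornerE.
by rewrite natr1.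
Qed.

(* The polar coefficients of core are polynomials in t invariant under t |-> t + 1. *)
Lemma ctm_spec b : all (fun x => 0 < x)%N b ->
  (b <> [::] -> pol (fun _ z => ctm b z)) /\ regv (renorm b) (Zw (zeroword b) [::]) /\
  (b <> [::] -> expands (phim (zeroword b) [::]) (fun _ z => ctm b z)).
Proof.
have [n] := ubnP (size b); elim: n b => // n IH [|b0 b].
  move=> _ _; split=> //; split=> //; apply: regv_ext regv1 _ => t _; apply: near0W => z _.
  by rewrite /renorm big_nat1 /= mulr1.
move=> sb /= /andP[b0p bp].
set w := zeroword (b0 :: b).
have wn : w <> [::] by [].
have wp : posword w by rewrite /posword unzip2_zeroword /= b0p.
have Hcore : expands (core phim w [::]) (prenorm (b0 :: b)).
  have H := @expands_core (fun w _ _ z => ctm (unzip2 w) z) w [::] wp.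
  have {}H : expands (core phim w [::]) (corefun (fun w _ _ z => ctm (unzip2 w) z) w [::]).
    apply: H => i d /andP[i0 iw]; rewrite inE => /eqP->.
    have -> : drop i w = zeroword (drop i (b0 :: b)) by rewrite /w /zeroword map_drop.
    rewrite unzip2_zeroword; apply: (proj2 (proj2 (IH _ _ _))).
    - by rewrite size_drop; move: iw sb; rewrite size_map /=; lia.
    - by apply/allP => x /mem_drop; apply: (allP (_ : all (fun x => 0 < x)%N (b0 :: b))); rewrite /= b0p.
    - by move/(congr1 size); move: iw; rewrite size_drop size_map /=; lia.
  apply: expands_ext H _ => t _; apply: near0W => z z0.
  have wpos : all (fun x => 0 < x)%N (b0 :: b) by rewrite /= b0p.
  have sw : size w = (size b).+1 by rewrite /w /= size_map.
  rewrite /corefun sw Fcoef_zeroword // /prenorm [in RHS]big_nat_recr //=.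
  (* The last term of [prenorm] has the empty counterterm 1 and is the unrenormalized series. *)
  rewrite take_size drop_size /= mulr1 addrC; congr (_ + _).
  apply: eq_big_nat => i /andP[i0 ib]; rewrite big_seq1.
  have -> : take i w = zeroword (take i (b0 :: b)) by rewrite /w /zeroword map_take.
  have -> : drop i w = zeroword (drop i (b0 :: b)) by rewrite /w /zeroword map_drop.
  rewrite unzip2_zeroword Fcoef_zeroword //.
  by apply/allP => x /mem_take; apply: (allP wpos).
set L := core phim w [::] in Hcore.
have [_ [HR _]] := IH b sb bp.
have Lcst k : (k < lord L)%N -> lcf L k = ((lcf L k).[0])%:P.
  move=> kL; apply: pshiftp_fix.
  have H1 := expandsD Hcore (expandsN (expands_trans 1 Hcore)).
  have H2 : regv (fun t z => prenorm (b0 :: b) t z - prenorm (b0 :: b) (t + 1%:R) z)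
      (1 * pshiftp 1 (Zw (zeroword b) [::])).
    apply: regv_ext (regvM (regv_exp b0 b0) (regv_trans 1 HR)) _ => t _.
    by apply: near0W => z z0; rewrite prenorm_diff.
  (* [ladd] doubles the pole order, so coefficient k of [L] is found at index k + [lord L], still in
     the polar range. *)
  have [/(_ (k + lord L)%N) + _] := expands_regv H1 H2.
  rewrite /= ltn_add2r => /(_ kL).
  by rewrite /Defs.lshift leq_addl addnK.
have polE t z : polfun L t z = polfun L 0 z.
  rewrite /polfun; congr (_ / _); apply: eq_bigr => k _; congr (_ * _).
  by rewrite /cf Lcst ?ltn_ord // map_polyC !hornerC.
have Hphim : expands (phim w [::]) (fun _ z => ctm (b0 :: b) z).
  apply: expands_ext (expands_phim _ wn) _ => t _; apply: near0W => z _ /=.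
  by rewrite -/L polE.
split; last split=> //.
  move=> _; apply: pol_ext (_ : pol (fun t z => - polfun L t z)) _.
    apply: polN; exists (lpolar L); first exact: expands_polar.
    by move=> k /= kL; rewrite ltnNge kL.
  by move=> t _; apply: near0W => z _ /=; rewrite polE.
rewrite Zw_core //; apply: regv_ext (regv_reg Hcore) _ => t _.
by apply: near0W => z z0; rewrite renormE /= -/w -/L polE addrC.
Qed.

Lemma regv_renorm b : all (fun x => 0 < x)%N b -> regv (renorm b) (Zw (zeroword b) [::]).
Proof. by case/ctm_spec => _ []. Qed.

Lemma pol_ctm b : all (fun x => 0 < x)%N b -> b <> [::] -> pol (fun _ z => ctm b z).
Proof. by case/ctm_spec. Qed.

(** * Words with a nonzero column *)

Lemma divsS a m : divs (a :: m) = [seq b :: d | b <- iota 0 a.+1, d <- divs m].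
Proof. by []. Qed.

Lemma mdiff_eq0 m d : d \in divs m -> all (fun e => e == 0%N) (mdiff m d) = (d == m).
Proof.
elim: m d => [|a m IH] d; first by rewrite inE => /eqP->.
rewrite divsS => /allpairsP[[b d'] []]; rewrite mem_iota /= => bI dI ->.
rewrite eqseq_cons -IH // /mdiff /=; congr (_ && _).
by move: bI; lia.
Qed.

Lemma uniq_divs m : uniq (divs m).
Proof.
elim: m => // a m IH; rewrite divsS; apply: allpairs_uniq; rewrite ?iota_uniq //.
by move=> [x i] [y j] _ _ /= [-> ->].
Qed.

Lemma mem_divs m : m \in divs m.
Proof.
elim: m => // a m IH; rewrite divsS; apply/allpairsP; exists (a, m); split=> //.
by rewrite mem_iota /=.
Qed.

(** Multiplication by a series concentrated on the monomial 1: only the divisor d = m survives. *)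
Lemma sum_divs m (F : seq nat -> RR) (c : RR) :
  \sum_(d <- divs m) F d * (if all (fun e => e == 0%N) (mdiff m d) then c else 0) = F m * c.
Proof.
rewrite (bigD1_seq m) ?mem_divs ?uniq_divs //= mdiff_eq0 ?mem_divs // eqxx.
rewrite big_seq_cond big1 ?addr0 // => d /andP[dm /negbTE dn].
by rewrite mdiff_eq0 // dn mulr0.
Qed.

(** The candidate for the counterterm of an arbitrary word, confirmed in [core_ctw]: it vanishes
    when some column has a nonzero first entry. *)
Definition ctw (w : word) (m : seq nat) (_ z : RR) : RR :=
  if all (fun x => x == 0%N) (unzip1 w) && all (fun e => e == 0%N) m
  then ctm (unzip2 w) z else 0.

Definition corew (u v : word) m t z k : RR :=
  Fcoef (u ++ take k v) m t z * ctm (unzip2 (drop k v)) z.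

Lemma allzero_last (u : seq nat) : u <> [::] -> (0 < last 1 u)%N -> all (fun x => x == 0%N) u = false.
Proof.
case/lastP: u => // u x _; rewrite last_rcons all_rcons => x0.
by case: eqP => //; lia.
Qed.

Lemma sum_ends n (G : nat -> RR) : (0 < n)%N ->
  G n + \sum_(1 <= i < n) G i + G 0%N = \sum_(0 <= i < n.+1) G i.
Proof. by move=> n0; rewrite big_nat_recr //= [in RHS]big_ltn //; ring. Qed.

(** A cut inside [u] leaves a suffix with a nonzero column, whose candidate counterterm is 0. The
    cuts at the end of [u] or inside [v] reassemble the renormalized series of [v], translated by
    [last 0 i]. *)
Lemma corefun_ctw (u v : word) m t z : z < 0 -> (0 < last 1 (unzip1 u))%N ->
  all (fun x => x == 0%N) (unzip1 v) -> posword v -> u ++ v <> [::] ->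
  corefun ctw (u ++ v) m t z + ctw (u ++ v) m t z =
  \sum_(i <- prefixes (unzip1 u) m)
    phase (unzip2 u) i t z * renorm (unzip2 v) (t + (last 0%N i)%:R) z.
Proof.
move=> z0 ul v0 vp wn.
pose H := corew u v m t z.
pose G i := if (size u <= i)%N then H (i - size u)%N else 0.
have HE k : H k = \sum_(i <- prefixes (unzip1 u) m) phase (unzip2 u) i t z *
    (tailsum (take k (unzip2 v)) (t + (last 0%N i)%:R) z * ctm (drop k (unzip2 v)) z).
  rewrite /H /corew Fcoef_cat //; last first.
  - by rewrite /unzip2 map_take; apply/allP => x /mem_take; apply: (allP vp).
  - by rewrite /unzip1 map_take; apply/allP => x /mem_take; apply: (allP v0).
  rewrite mulr_suml; apply: eq_bigr => i _.
  by rewrite /unzip2 map_take map_drop mulrA.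
have GE i : (i < size (u ++ v))%N -> (0 < i)%N ->
    \sum_(d <- divs m) Fcoef (take i (u ++ v)) d t z * ctw (drop i (u ++ v)) (mdiff m d) t z = G i.
  move=> iw i0; rewrite /ctw /G; case: ltnP => iu; last first.
    rewrite take_cat drop_cat ltnNge iu /=.
    have -> : all (fun x => x == 0%N) (unzip1 (drop (i - size u) v)).
      by rewrite /unzip1 map_drop; apply/allP => x /mem_drop; apply: (allP v0).
    by rewrite sum_divs.
  apply: big1 => d _; rewrite drop_cat iu /unzip1 map_cat all_cat.
  rewrite allzero_last ?mulr0 //.
    by move/(congr1 size); rewrite size_map size_drop /=; lia.
  rewrite map_drop; move: ul; rewrite -{1}(cat_take_drop i (unzip1 u)) last_cat.
  have : drop i (unzip1 u) <> [::].
    by move/(congr1 size); rewrite size_drop size_map /=; lia.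
  by case: (drop i (unzip1 u)).
(* The added [ctw] is the cut at position 0, which counts only when [u] is empty. *)
have G0 : ctw (u ++ v) m t z = G 0%N.
  rewrite /ctw /G leqn0 size_eq0; case: eqP => [u0|un].
    rewrite /H /corew u0 subn0 take0 drop0 /= v0 /=.
    rewrite -{1}[[::] : word]cat0s Fcoef_cat //= all_zero_prefixes; case: ifP => _.
      by rewrite big_seq1 /phase big_ord0 mulr0 exp.expR0 !mul1r.
    by rewrite big_nil mul0r.
  rewrite /unzip1 map_cat all_cat allzero_last //.
  by move=> /(congr1 size); rewrite size_map; case: (u) un.
have Gn : Fcoef (u ++ v) m t z = G (size (u ++ v)).
  rewrite /G size_cat leq_addr addKn /H /corew take_size drop_size /= mulr1 //.
have wn0 : (0 < size (u ++ v))%N by case: (u ++ v) wn.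
rewrite /corefun (eq_big_nat _ _ (F2 := G)); last by move=> i /andP[i0 iw]; exact: GE.
transitivity (\sum_(0 <= i < (size (u ++ v)).+1) G i).
  by rewrite Gn G0 sum_ends.
rewrite size_cat -addnS (big_cat_nat (n := size u)) ?leq_addr //= big1_seq ?add0r; last first.
  by move=> i /andP[_]; rewrite mem_index_iota /G => /andP[_ iu]; rewrite leqNgt iu.
rewrite -{1}(add0n (size u)) big_addn addKn /renorm size_map.
under eq_bigr => k _ do rewrite /G leq_addl addnK HE.
rewrite exchange_big /=; apply: eq_bigr => i _.
by rewrite mulr_sumr.
Qed.

Lemma regv_corefun (u v : word) m : (0 < last 1 (unzip1 u))%N ->
  all (fun x => x == 0%N) (unzip1 v) -> posword v -> u ++ v <> [::] ->
  regv (fun t z => corefun ctw (u ++ v) m t z + ctw (u ++ v) m t z)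
    (\sum_(i <- prefixes (unzip1 u) m)
       pshiftp (last 0%N i) (Zw (zeroword (unzip2 v)) [::])).
Proof.
move=> ul v0 vp wn.
have H : regv (fun t z => \sum_(i <- prefixes (unzip1 u) m)
    phase (unzip2 u) i t z * renorm (unzip2 v) (t + (last 0%N i)%:R) z)
    (\sum_(i <- prefixes (unzip1 u) m) 1 * pshiftp (last 0%N i) (Zw (zeroword (unzip2 v)) [::])).
  apply: regv_sum => i _; apply: regvM; first exact: regv_phase.
  by apply: regv_trans; apply: regv_renorm.
rewrite (eq_bigr (fun i => 1 * pshiftp (last 0%N i) (Zw (zeroword (unzip2 v)) [::]))); last first.
  by move=> i _; rewrite mul1r.
apply: regv_ext H _ => t _; apply: near0W => z z0.
by rewrite corefun_ctw.
Qed.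

Lemma pol_ctw w m : posword w -> w <> [::] -> pol (ctw w m).
Proof.
move=> wp wn.
case E : (all (fun x => x == 0%N) (unzip1 w) && all (fun e => e == 0%N) m).
  apply: pol_ext (pol_ctm wp _) _; first by case: w wn {wp E}.
  by move=> t _; apply: near0W => z _; rewrite /ctw E.
by apply: pol_ext pol0 _ => t _; apply: near0W => z _; rewrite /ctw E.
Qed.

(** Adding [ctw] to the core function makes it regular, and so does subtracting its polar part.
    Hence the sum of [ctw] and the polar part is both regular and polar, so it is 0: the candidate
    is the true counterterm. *)
Lemma core_ctw w m : posword w -> w <> [::] ->
  expands (core phim w m) (corefun ctw w m) ->
  expands (phim w m) (ctw w m) /\
  forall p, regv (fun t z => corefun ctw w m t z + ctw w m t z) p -> Zw w m = p.
Proof.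
move=> wp wn H.
have [u [v [E ul v0]]] := word_split w.
have vp : posword v by move: wp; rewrite E posword_cat => /andP[].
have := @regv_corefun u v m ul v0 vp; rewrite -E => /(_ wn).
set q := \sum_(i <- _) _ => Hq.
have R := regv_reg H; set L := core phim w m in H R.
have P : forall t, 0 <= t -> near0 (fun z => ctw w m t z + polfun L t z = 0).
  apply: (@regv_pol _ (q - lcoef0 L)); last first.
    apply: polD; first exact: pol_ctw.
    exists (lpolar L); first exact: expands_polar.
    by move=> k /= kL; rewrite ltnNge kL.
  by apply: regv_ext (regvD Hq (regvN R)) _ => t _; apply: near0W => z _; ring.
split.
  apply: expands_ext (expands_phim _ wn) _ => t t0.
  by apply: near0S (P t t0) => z _ /eqP; rewrite addr_eq0 => /eqP->.
move=> p Hp; rewrite Zw_core //; apply: regv_unique R _.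
apply: regv_ext Hp _ => t t0.
by apply: near0S (P t t0) => z _ /eqP; rewrite addr_eq0 => /eqP->.
Qed.

Lemma expands_phim_ctw w m : posword w -> w <> [::] -> expands (phim w m) (ctw w m).
Proof.
have [n] := ubnP (size w); elim: n w m => // n IH w m sw wp wn.
apply: (proj1 (core_ctw wp wn _)); apply: expands_core => // i d /andP[i0 iw] _.
apply: IH; first by rewrite size_drop; lia.
  exact: posword_drop.
by move/(congr1 size); rewrite size_drop /=; lia.
Qed.

(** Each phase factor has value 1 at z = 0, so the second entries of [u] disappear and only the
    translation by [last 0 i] remains. *)
Lemma Zw_cat (u v : word) m : (0 < last 1 (unzip1 u))%N ->
  all (fun x => x == 0%N) (unzip1 v) -> posword (u ++ v) -> u ++ v <> [::] ->
  Zw (u ++ v) m = \sum_(i <- prefixes (unzip1 u) m)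
       pshiftp (last 0%N i) (Zw (zeroword (unzip2 v)) [::]).
Proof.
move=> ul v0 wp wn.
have vp : posword v by move: wp; rewrite posword_cat => /andP[].
have H : expands (core phim (u ++ v) m) (corefun ctw (u ++ v) m).
  apply: expands_core => // i d /andP[i0 iw] _.
  apply: expands_phim_ctw; first exact: posword_drop.
  by move/(congr1 size); rewrite size_drop /=; lia.
by apply: (proj2 (core_ctw wp wn H)); apply: regv_corefun.
Qed.

(** * Quasi-shuffle relations and symmetrization *)

Fixpoint ins (a : nat) (w : seq nat) : seq (seq nat) :=
  if w is b :: w' then (a :: w) :: [seq b :: x | x <- ins a w'] else [:: [:: a]].

Fixpoint mrg (a : nat) (w : seq nat) : seq (seq nat) :=
  if w is b :: w' then ((a + b)%N :: w') :: [seq b :: x | x <- mrg a w'] else [::].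

(* sum of F over the quasi-shuffle product of the letter a with the word w *)
Definition qsum (V : zmodType) (F : seq nat -> V) (a : nat) (w : seq nat) : V :=
  \sum_(x <- ins a w) F x + \sum_(x <- mrg a w) F x.

Section QSum.
Variable V : zmodType.
Implicit Type F G : seq nat -> V.

Lemma qsum0 F a : qsum F a [::] = F [:: a].
Proof. by rewrite /qsum big_seq1 big_nil addr0. Qed.

Lemma qsumS F a b w : qsum F a (b :: w) =
  F [:: a, b & w] + F ((a + b)%N :: w) + qsum (fun x => F (b :: x)) a w.
Proof. by rewrite /qsum !big_cons !big_map addrACA. Qed.

(** All words of a quasi-shuffle have the same total weight, so functions need to agree only there.
    This lets the weight-dependent leading factor of [tailsum] be pulled out. *)
Lemma eq_qsum F G a w : (forall x, sumn x = (a + sumn w)%N -> F x = G x) ->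
  qsum F a w = qsum G a w.
Proof.
elim: w F G => [|b w IH] F G FG; first by rewrite !qsum0 FG.
rewrite !qsumS !FG /= ?addnA //; congr (_ + _); apply: IH => x sx.
by apply: FG; rewrite /= sx; lia.
Qed.

Lemma qsumD F G a w : qsum (fun x => F x + G x) a w = qsum F a w + qsum G a w.
Proof. by rewrite /qsum !big_split addrACA. Qed.
End QSum.

Lemma qsumZ (R : comNzRingType) (c : R) (F : seq nat -> R) a w :
  qsum (fun x => c * F x) a w = c * qsum F a w.
Proof. by rewrite /qsum mulrDr !mulr_sumr. Qed.

Lemma pol_qsum (F : seq nat -> RR -> RR -> RR) a w :
  (forall x, x <> [::] -> all (fun x => 0 < x)%N x -> pol (F x)) ->
  (0 < a)%N -> all (fun x => 0 < x)%N w ->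
  pol (fun t z => qsum (fun x => F x t z) a w).
Proof.
move=> H a0; elim: w F H => [|b w IH] F H.
  move=> _; apply: pol_ext (H [:: a] _ _) _; rewrite //= ?a0 // => t _.
  by apply: near0W => z _; rewrite qsum0.
move=> /= /andP[b0 wp].
have h1 : pol (F [:: a, b & w]) by apply: H; rewrite //= a0 b0.
have h2 : pol (F ((a + b)%N :: w)) by apply: H; rewrite //= addn_gt0 a0.
have h3 : pol (fun t z => qsum (fun x => F (b :: x) t z) a w).
  by apply: (IH (fun x => F (b :: x))) => // x _ xp; apply: H; rewrite //= b0.
apply: pol_ext (polD (polD h1 h2) h3) _ => t _; apply: near0W => z _.
by rewrite qsumS.
Qed.

Lemma regv_qsum (F : seq nat -> RR -> RR -> RR) p a w :
  (forall x, all (fun x => 0 < x)%N x -> regv (F x) (p x)) ->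
  (0 < a)%N -> all (fun x => 0 < x)%N w ->
  regv (fun t z => qsum (fun x => F x t z) a w) (qsum p a w).
Proof.
move=> H a0; elim: w F p H => [|b w IH] F p H.
  move=> _; rewrite qsum0; apply: regv_ext (H [:: a] _) _; rewrite //= ?a0 // => t _.
  by apply: near0W => z _; rewrite qsum0.
move=> /= /andP[b0 wp].
have h1 : regv (F [:: a, b & w]) (p [:: a, b & w]) by apply: H; rewrite /= a0 b0.
have h2 : regv (F ((a + b)%N :: w)) (p ((a + b)%N :: w)) by apply: H; rewrite /= addn_gt0 a0.
have h3 : regv (fun t z => qsum (fun x => F (b :: x) t z) a w) (qsum (fun x => p (b :: x)) a w).
  by apply: (IH (fun x => F (b :: x))) => // x xp; apply: H; rewrite /= b0.
rewrite qsumS; apply: regv_ext (regvD (regvD h1 h2) h3) _ => t _; apply: near0W => z _.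
by rewrite qsumS.
Qed.

(** In the double sum of e^(mx + ny) over m, n > 0, the ranges m > n, m < n and m = n give the three
    terms. *)
Lemma geoM (x y : RR) : x < 0 -> y < 0 ->
  geo x * geo y = geo (x + y) * (geo x + geo y + 1).
Proof.
move=> x0 y0; have xy0 : x + y < 0 by lra.
have h (w : RR) : w < 0 -> 1 - expR w != 0 by move=> w0; rewrite subr_eq0 eq_sym lt_eqF // expR_lt1.
move: (h _ x0) (h _ y0) (h _ xy0); rewrite /geo exp.expRD => h1 h2 h3.
by field; rewrite h1 h2 h3.
Qed.

(** A quasi-shuffle word begins with a, a + b or b, always with the same leading geometric factor;
    these cases match the three terms of [geoM]. *)
Lemma tailsum_qsum a w t z : z < 0 -> (0 < a)%N -> all (fun x => 0 < x)%N w ->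
  qsum (fun x => tailsum x t z) a w = tailsum [:: a] t z * tailsum w t z.
Proof.
move=> z0 a0; elim: w => [|b w IH] /=; first by rewrite qsum0 /= !mulr1.
move=> /andP[b0 wp]; rewrite qsumS /=.
rewrite (eq_qsum (G := fun x => expR (t * b%:R * z) * geo ((b + (a + sumn w))%:R * z) * tailsum x t z)); last first.
  by move=> x ->.
rewrite qsumZ IH //= addn0.
have an : a%:R * z < 0 :> RR by rewrite pmulr_rlt0 // ltr0n.
have bn : (b + sumn w)%:R * z < 0 :> RR by rewrite pmulr_rlt0 // ltr0n addn_gt0 b0.
have := geoM an bn.
have -> : a%:R * z + (b + sumn w)%:R * z = (a + (b + sumn w))%:R * z :> RR.
  by rewrite [in RHS]natrD mulrDl.
have -> : (b + (a + sumn w))%N = (a + (b + sumn w))%N by lia.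
have -> : (a + b + sumn w)%N = (a + (b + sumn w))%N by lia.
have -> : t * (a + b)%:R * z = t * a%:R * z + t * b%:R * z by rewrite natrD; ring.
rewrite exp.expRD => E.
transitivity (expR (t * a%:R * z) * expR (t * b%:R * z) * tailsum w t z *
  (geo (a%:R * z) * geo ((b + sumn w)%:R * z))); last by ring.
rewrite E; ring.
Qed.

(** Convolution over the cuts of [w], as in [convE]; the prefix is absorbed into F, which suits
    induction on the word. *)
Fixpoint conv (F G : seq nat -> RR) (w : seq nat) : RR :=
  F [::] * G w + (if w is b :: w' then conv (fun x => F (b :: x)) G w' else 0).

Lemma convE F G w : conv F G w = \sum_(0 <= i < (size w).+1) F (take i w) * G (drop i w).
Proof.
elim: w F => [|b w IH] F /=; first by rewrite big_nat1 addr0.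
by rewrite IH [RHS]big_ltn // big_add1.
Qed.

Lemma eq_conv F F' G G' w : F =1 F' -> (forall i, G (drop i w) = G' (drop i w)) ->
  conv F G w = conv F' G' w.
Proof.
by move=> FF GG; rewrite !convE; apply: eq_bigr => i _; rewrite FF GG.
Qed.

Lemma convDl F F' G w : conv (fun x => F x + F' x) G w = conv F G w + conv F' G w.
Proof. by rewrite !convE -big_split; apply: eq_bigr => i _; rewrite mulrDl. Qed.

Lemma convZl c F G w : conv (fun x => c * F x) G w = c * conv F G w.
Proof. by rewrite !convE mulr_sumr; apply: eq_bigr => i _; rewrite mulrA. Qed.

Lemma convZr c F G w : conv F (fun x => c * G x) w = c * conv F G w.
Proof. by rewrite !convE mulr_sumr; apply: eq_bigr => i _; rewrite mulrCA. Qed.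

(* the coproduct (deconcatenation) is multiplicative for the quasi-shuffle product *)
Lemma qsum_conv F G a w :
  qsum (conv F G) a w = conv (qsum F a) G w + conv F (qsum G a) w.
Proof.
elim: w F => [|b w IH] F; first by rewrite /= !qsum0 /=; ring.
rewrite qsumS /= qsumD qsumZ IH qsum0 qsumS.
rewrite (eq_conv (F := fun x => qsum F a (b :: x))
  (F' := fun x => (F [:: a, b & x] + F ((a + b)%N :: x)) + qsum (fun y => F (b :: y)) a x) (G' := G)) //; last first.
  by move=> x; rewrite qsumS.
by rewrite !convDl; ring.
Qed.

Lemma renorm_conv b t z : renorm b t z = conv (fun x => tailsum x t z) (ctm ^~ z) b.
Proof. by rewrite convE. Qed.

Lemma renorm1 a t z : renorm [:: a] t z = ctm [:: a] z + tailsum [:: a] t z.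
Proof. by rewrite renorm_conv /=; ring. Qed.

Definition ctmM (a : nat) (v : seq nat) (z : RR) : Prop :=
  qsum (ctm ^~ z) a v = ctm [:: a] z * ctm v z.

Lemma eq_conv_tail F G G' w : F [::] = 1 ->
  (forall i, (0 < i)%N -> G (drop i w) = G' (drop i w)) ->
  conv F G w = conv F G' w + (G w - G' w).
Proof.
move=> F1 H; rewrite !convE big_ltn // [X in _ = X + _]big_ltn // !take0 !drop0 F1 !mul1r.
rewrite (@eq_big_nat _ _ _ 1 _ _ (fun i => F (take i w) * G' (drop i w))).
  by rewrite [RHS]addrAC addrCA subrr addr0 //.
by move=> i /andP[i0 _]; rewrite H.
Qed.

(** Convolving [tailsum] with counterterms multiplicative on proper suffixes is multiplicative up to
    the defect on the full word, which does not involve t. *)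
Lemma qsum_renorm a w t z : z < 0 -> (0 < a)%N -> all (fun x => 0 < x)%N w ->
  (forall i, (0 < i)%N -> ctmM a (drop i w) z) ->
  qsum (fun x => renorm x t z) a w =
  renorm [:: a] t z * renorm w t z + (qsum (ctm ^~ z) a w - ctm [:: a] z * ctm w z).
Proof.
move=> z0 a0 wp H.
rewrite (eq_qsum (G := conv (fun x => tailsum x t z) (ctm ^~ z))); last first.
  by move=> x _; rewrite renorm_conv.
rewrite qsum_conv renorm1 mulrDl renorm_conv.
have -> : conv (qsum (fun x => tailsum x t z) a) (ctm ^~ z) w =
    tailsum [:: a] t z * conv (fun x => tailsum x t z) (ctm ^~ z) w.
  rewrite -convZl !convE; apply: eq_bigr => i _; congr (_ * _).
  rewrite tailsum_qsum //; apply/allP => x /mem_take; exact: (allP wp).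
have -> : conv (fun x => tailsum x t z) (qsum (ctm ^~ z) a) w =
    ctm [:: a] z * conv (fun x => tailsum x t z) (ctm ^~ z) w +
    (qsum (ctm ^~ z) a w - ctm [:: a] z * ctm w z).
  by rewrite -convZr; apply: eq_conv_tail.
rewrite addrA; congr (_ + _); exact: addrC.
Qed.

(** The defect is polar as a combination of counterterms, and regular by [qsum_renorm], hence 0.
    Quantifying over i inside [near0] gives all suffixes a common neighbourhood. *)
Lemma near0_ctmM a w : (0 < a)%N -> all (fun x => 0 < x)%N w ->
  near0 (fun z => forall i, ctmM a (drop i w) z).
Proof.
move=> a0; elim: w => [_|b w IH /= /andP[b0 wp]].
  by apply: near0W => z _ i; rewrite /ctmM /= qsum0 /= mulr1.
have {IH} H := IH wp.
have bwp : all (fun x => 0 < x)%N (b :: w) by rewrite /= b0.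
have P : pol (fun _ z => qsum (ctm ^~ z) a (b :: w) - ctm [:: a] z * ctm (b :: w) z).
  apply: polD; first by apply: (@pol_qsum (fun x _ z => ctm x z)) => // x xn xp; exact: pol_ctm.
  by apply: polN; apply: polM; apply: pol_ctm; rewrite //= a0.
have R := regv_qsum (fun x xp => regv_renorm xp) a0 bwp.
have R2 : regv (renorm [:: a]) (Zw (zeroword [:: a]) [::]) by apply: regv_renorm; rewrite /= a0.
have R3 := regvD R (regvN (regvM R2 (regv_renorm bwp))).
have [p {R R2 R3}R] : exists p,
    regv (fun _ z => qsum (ctm ^~ z) a (b :: w) - ctm [:: a] z * ctm (b :: w) z) p.
  eexists; apply: regv_ext R3 _ => t t0; apply: near0S H => z z0 Hz.
  rewrite qsum_renorm //; first by rewrite addrAC subrr add0r.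
  by move=> [//|i] _; apply: Hz.
(* The defect is constant in t, so t = 0 suffices; proper suffixes are covered by the induction. *)
have := regv_pol R P (lexx 0); apply: near0S2 H => z z0 Hz E [|i]; last exact: Hz.
by apply/eqP; rewrite -subr_eq0 drop0 E.
Qed.

Lemma Zw_qsum a w : (0 < a)%N -> all (fun x => 0 < x)%N w ->
  qsum (fun x => Zw (zeroword x) [::]) a w = Zw (zeroword [:: a]) [::] * Zw (zeroword w) [::].
Proof.
move=> a0 wp.
have R := regv_qsum (fun x xp => regv_renorm xp) a0 wp.
have R2 : regv (renorm [:: a]) (Zw (zeroword [:: a]) [::]) by apply: regv_renorm; rewrite /= a0.
apply: regv_unique (regvM R2 (regv_renorm wp)).
apply: regv_ext R _ => t t0; apply: near0S (near0_ctmM a0 wp) => z z0 Hz.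
by rewrite qsum_renorm //; have := Hz 0%N; rewrite drop0 /ctmM => ->; rewrite subrr addr0.
Qed.

Lemma lcoef0_regv_pol L F G p : regv F p -> pol G ->
  expands L (fun t z => F t z + G t z) -> lcoef0 L = p.
Proof.
move=> [L1 [H1 r1 <-]] [L2 H2 r2] H.
have := expands_unique H (expandsD H1 H2) (lord L1 + lord L2 + lord L)%N.
have -> : lord (ladd L1 L2) = (lord L1 + lord L2)%N by [].
rewrite {1 2}/Defs.lshift leq_addr addKn leq_addl addnK /=.
by rewrite /Defs.lshift leq_addl addnK leq_addr addKn (r2 _ (leqnn _)) addr0.
Qed.

(** Dropping the polar counterterm does not change the constant coefficient, which is thus that of
    e^(atz) (-1/(az) - 1/2 + ...). The pole cancels the factor a of the exponent. *)
Lemma Zw_letter a : (0 < a)%N -> Zw (zeroword [:: a]) [::] = - 'X - (2^-1)%:P.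
Proof.
move=> a0.
have R : regv (renorm [:: a]) (Zw (zeroword [:: a]) [::]) by apply: regv_renorm; rewrite /= a0.
have P : pol (fun _ z => - ctm [:: a] z) by apply: polN; apply: pol_ctm; rewrite //= a0.
rewrite -(@lcoef0_regv_pol (lmul (lexp 0 a) (lgeo a)) _ _ _ R P); last first.
  apply: expands_ext (expandsM (expands_exp 0 a) (expands_geo a0)) _ => t _.
  apply: near0W => z _; rewrite renorm1 addrAC subrr add0r.
  by rewrite /= addn0 mulr1 add0r [a%:R * t]mulrC.
rewrite /lcoef0 /= !big_ord_recl big_ord0 /= bern1 [bern 0]/bern /= addr0.
have an : a%:R != 0 :> rat by rewrite pnatr_eq0 -lt0n.
rewrite fact0 invr1 !scale1r expr0 mul1r add0r expr1 -mul_polyC.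
have -> : bump 0 0 = 1%N by [].
rewrite !expr1 subnn expr0 addr0 mul1r mulrAC -polyCM.
have -> : a%:R * (- 1 / a%:R) = -1 :> rat by field.
have -> : - (- 2^-1 * a%:R + a%:R) / a%:R = - 2^-1 :> rat by field.
by rewrite !polyCN polyC1 mulN1r addrC.
Qed.

(** * Sums over rearrangements *)

Lemma size_mrg a w : size (mrg a w) = size w.
Proof. by elim: w => //= b w IH; rewrite size_map IH. Qed.

Lemma mem_mrg a w x : (0 < a)%N -> all (fun x => 0 < x)%N w -> x \in mrg a w ->
  size x = size w /\ all (fun x => 0 < x)%N x.
Proof.
move=> a0; elim: w x => //= b w IH x /andP[b0 wp]; rewrite inE => /orP[/eqP->|/mapP[y /(IH _ wp)[<- yp] ->]] /=.
  by rewrite addn_gt0 a0 wp.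
by rewrite b0.
Qed.

Section SymSum.
Variable R : comNzRingType.
Implicit Type F : seq nat -> R.

Lemma sum_ins_cons F a b w :
  \sum_(x <- ins a (b :: w)) F x = F [:: a, b & w] + \sum_(x <- ins a w) F (b :: x).
Proof. by rewrite /= big_cons big_map. Qed.

Lemma sum_mrg_cons F a b w :
  \sum_(x <- mrg a (b :: w)) F x = F ((a + b)%N :: w) + \sum_(x <- mrg a w) F (b :: x).
Proof. by rewrite /= big_cons big_map. Qed.

(** After b is inserted, a merges either with b, which inserts a + b, or with a letter of [w], which
    commutes with the insertion. *)
Lemma sum_ins_mrg F a b w :
  \sum_(x <- ins b w) \sum_(y <- mrg a x) F y =
  \sum_(y <- ins (a + b) w) F y + \sum_(x <- mrg a w) \sum_(y <- ins b x) F y.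
Proof.
elim: w F => [|c w IH] F.
  by rewrite /= !(big_cons, big_nil) /= !(big_cons, big_nil, addr0).
rewrite !sum_ins_cons !sum_mrg_cons sum_ins_cons.
rewrite [X in _ + X = _](eq_bigr (fun x => F ((a + c)%N :: x) + \sum_(y <- mrg a x) F (c :: y))); last first.
  by move=> x _; rewrite sum_mrg_cons.
rewrite [X in _ = _ + (_ + X)](eq_bigr (fun x => F [:: b, c & x] + \sum_(y <- ins b x) F (c :: y))); last first.
  by move=> x _; rewrite sum_ins_cons.
rewrite !big_split /= (IH (fun x => F (c :: x))).
ring.
Qed.

(* sum of F over all rearrangements (with multiplicity) of a word *)
Fixpoint symsum (F : seq nat -> R) (w : seq nat) : R :=
  if w is a :: w' then symsum (fun x => \sum_(y <- ins a x) F y) w' else F [::].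

Lemma mem_ins a w x : x \in ins a w -> perm_eq x (a :: w).
Proof.
elim: w x => [|b w IH] x /=; first by rewrite inE => /eqP->.
rewrite inE => /orP[/eqP->//|/mapP[y /IH yp ->]].
apply: (@perm_trans _ [:: b, a & w]); first by rewrite perm_cons.
by rewrite -[[:: b, a & w]]/([:: b] ++ [:: a] ++ w) perm_catCA.
Qed.

Lemma eq_symsum F G w : (forall x, perm_eq x w -> F x = G x) -> symsum F w = symsum G w.
Proof.
elim: w F G => [|a w IH] F G FG /=; first exact: FG.
apply: IH => x xw; apply: eq_big_seq => y /mem_ins yx; apply: FG.
by apply: perm_trans yx _; rewrite perm_cons.
Qed.

Lemma symsumD F G w : symsum (fun x => F x + G x) w = symsum F w + symsum G w.
Proof.
elim: w F G => //= a w IH F G; rewrite -IH; apply: eq_symsum => x _.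
by rewrite big_split.
Qed.

Lemma symsumZ c F w : symsum (fun x => c * F x) w = c * symsum F w.
Proof.
elim: w F => //= a w IH F; rewrite -IH; apply: eq_symsum => x _.
by rewrite mulr_sumr.
Qed.

Lemma symsum_mrg F a w :
  symsum (fun x => \sum_(y <- mrg a x) F y) w = \sum_(x <- mrg a w) symsum F x.
Proof.
elim: w F => [|b w IH] F /=; first by rewrite !big_nil.
rewrite big_cons big_map /= -IH -symsumD; apply: eq_symsum => x _.
exact: sum_ins_mrg.
Qed.

Fixpoint arrangements (w : seq nat) : seq (seq nat) :=
  if w is a :: w' then flatten [seq ins a x | x <- arrangements w'] else [:: [::]].

Lemma symsumE F w : symsum F w = \sum_(x <- arrangements w) F x.
Proof.
elim: w F => [|a w IH] F /=; first by rewrite big_seq1.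
by rewrite IH big_flatten big_map.
Qed.
End SymSum.

Lemma symsum_map (R : comNzRingType) (F : seq nat -> R) (f : nat -> nat) w :
  symsum F (map f w) = symsum (fun x => F (map f x)) w.
Proof.
elim: w F => //= a w IH F; rewrite IH; apply: eq_symsum => x _.
have -> : ins (f a) (map f x) = [seq map f y | y <- ins a x].
  by elim: x => //= b x ->; rewrite -!map_comp.
by rewrite big_map.
Qed.

Lemma size_ins a w : size (ins a w) = (size w).+1.
Proof. by elim: w => //= b w IH; rewrite size_map IH. Qed.

Lemma ins_cat a p q : p ++ a :: q \in ins a (p ++ q).
Proof.
elim: p => [|b p IH] /=; first by case: q => [|c q]; rewrite /= inE eqxx.
by rewrite inE; apply/orP; right; apply/mapP; exists (p ++ a :: q).
Qed.

Lemma mem_arrangements w x : (x \in arrangements w) = perm_eq x w.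
Proof.
elim: w x => [|a w IH] x /=; first by rewrite inE; apply/eqP/perm_nilP.
apply/flatten_mapP/idP => [[y yw /mem_ins xy]|xp].
  by apply: perm_trans xy _; rewrite perm_cons -IH.
have ax : a \in x by rewrite (perm_mem xp) mem_head.
case/splitPr: ax xp => p q xp; exists (p ++ q); last exact: ins_cat.
by rewrite IH -(perm_cons a) -(permPr xp) perm_sym -cat1s perm_catCA.
Qed.

Lemma size_arrangements w : size (arrangements w) = (size w)`!.
Proof.
elim: w => //= a w IH; rewrite size_flatten /shape -map_comp.
rewrite (eq_in_map _ (fun=> (size w).+1) _).1; last first.
  by move=> x; rewrite mem_arrangements => /perm_size <-; rewrite /= size_ins.
have E (s : seq (seq nat)) : sumn [seq (size w).+1 | _ <- s] = ((size w).+1 * size s)%N.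
  by elim: s => [|x s /= ->]; rewrite ?muln0 // mulnS.
by rewrite E IH factS.
Qed.

(** The letters [b k] may repeat, so the comparison is made on the distinct positions 0, ..., n - 1:
    permutations give distinct arrangements, and both sides number n!. *)
Lemma perm_sumE (R : comNzRingType) n (b : nat -> nat) (F : seq nat -> R) :
  \sum_(s : 'S_n) F [seq b (s i) | i <- enum 'I_n] = symsum F (map b (iota 0 n)).
Proof.
rewrite symsum_map symsumE.
pose l := [seq [seq val (s i) | i <- enum 'I_n] | s : 'S_n <- enum {perm 'I_n}].
have lu : uniq l.
  rewrite map_inj_uniq ?enum_uniq // => s s' /eq_in_map E.
  by apply/permP => i; apply: val_inj; apply: E; rewrite mem_enum.
have ls : {subset l <= arrangements (iota 0 n)}.
  move=> _ /mapP[s _ ->]; rewrite mem_arrangements -val_enum_ord (map_comp val s).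
  apply: perm_map; apply: uniq_perm; rewrite ?(map_inj_uniq perm_inj) ?enum_uniq //.
  move=> i; rewrite mem_enum; apply/mapP; exists ((s^-1)%g i).
    by rewrite mem_enum.
  by rewrite permKV.
have sz : (size (arrangements (iota 0 n)) <= size l)%N.
  by rewrite size_arrangements size_iota size_map -cardE card_Sn.
have [_ lE] := uniq_min_size lu ls sz.
have lp : perm_eq l (arrangements (iota 0 n)).
  exact: uniq_perm lu (leq_size_uniq lu ls sz) lE.
rewrite -(perm_big _ lp) /= big_map big_enum /=; apply: eq_bigr => s _.
by rewrite -map_comp.
Qed.

(** Up to the sign (-1)^n, the rising factorial (t + 1/2)(t + 3/2)...(t + n - 1/2). *)
Definition symZ (n : nat) : {poly rat} :=
  \prod_(k < n) (- 'X - (2^-1)%:P - k%:R).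

(** Inserting a equals multiplying by Z(0; a) minus the merged words. The latter are as long as [w]
    and there are [size w] of them, so induction gives the next factor -t - 1/2 - [size w]. *)
Lemma symsum_Zw w : all (fun x => 0 < x)%N w ->
  symsum (fun x => Zw (zeroword x) [::]) w = symZ (size w).
Proof.
have [n] := ubnP (size w); elim: n w => // n IH [_ _|a w].
  by rewrite /= /symZ big_ord0.
move=> /= sw /andP[a0 wp].
rewrite (eq_symsum (G := fun x => (- 'X - (2^-1)%:P) * Zw (zeroword x) [::]
   + (- 1) * (\sum_(y <- mrg a x) Zw (zeroword y) [::]))); last first.
  move=> x /perm_all xw; rewrite -(Zw_letter a0) -Zw_qsum ?xw //.
  by rewrite /qsum mulN1r addrK.
rewrite symsumD !symsumZ symsum_mrg IH //.
rewrite (eq_big_seq (fun=> symZ (size w))); last first.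
  by move=> x /(mem_mrg a0 wp)[sx xp]; rewrite IH ?sx.
rewrite big_const_seq count_predT size_mrg iter_addr_0 /symZ big_ord_recr /=.
by rewrite -mulr_natr; ring.
Qed.

(** * Splitting off the trailing zeros and deducing the four identities *)

Lemma ntz_split (alpha : seq nat) : exists2 a : seq nat,
  alpha = a ++ nseq (ntz alpha) 0%N & (0 < last 1 a)%N.
Proof.
elim/last_ind: alpha => [|s x [a E al]]; first by exists [::].
rewrite /ntz rev_rcons /=; case: eqP => [->|/eqP x0] /=.
  exists a => //; rewrite -/(ntz s) {1}E -cats1 -catA; congr (_ ++ _).
  by rewrite -[[:: 0%N]]/(nseq 1 0%N) -nseqD addn1.
by exists (rcons s x); rewrite ?cats0 // last_rcons lt0n.
Qed.

Lemma Zc_cat (a b c : seq nat) m : (0 < last 1 a)%N -> size b = size a ->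
  all (fun x => 0 < x)%N b -> all (fun x => 0 < x)%N c -> a ++ c <> [::] ->
  Zc (a ++ nseq (size c) 0%N) (b ++ c) m =
  \sum_(i <- prefixes a m) pshiftp (last 0%N i) (Zw (zeroword c) [::]).
Proof.
move=> al sb bp cp ne; rewrite /Zc zip_cat //.
have z1 : unzip1 (zip a b) = a by rewrite unzip1_zip ?sb.
have z2 : unzip2 (zip a b) = b by rewrite unzip2_zip ?sb.
have z3 : unzip1 (zip (nseq (size c) 0%N) c) = nseq (size c) 0%N by rewrite unzip1_zip ?size_nseq.
have z4 : unzip2 (zip (nseq (size c) 0%N) c) = c by rewrite unzip2_zip ?size_nseq.
rewrite Zw_cat ?z1 ?z3 ?z4 //.
- by rewrite all_nseq orbT.
- by rewrite posword_cat /posword z2 z4 bp.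
- move/(congr1 size); rewrite size_cat !size_zip sb size_nseq !minnn -size_cat.
  by move/size0nil.
Qed.

Lemma pshiftp_sum (T : finType) n (F : T -> {poly rat}) :
  \sum_s pshiftp n (F s) = pshiftp n (\sum_s F s).
Proof. by rewrite /pshiftp rmorph_sum. Qed.

Theorem theorem4p8 (alpha : seq nat) (delta : nat) :
  (0 < size alpha)%N -> (0 < delta)%N ->
  [/\
   (* (1) *)
   (0 < last 0%N alpha)%N ->
     forall m : seq nat,
       Zc alpha [seq (a + delta)%N | a <- alpha] m = ((Mcoef alpha m)%:R)%:P,
   (* (2) *)
   last 0%N alpha = 0%N ->
     forall beta : seq nat, size beta = size alpha -> all (fun b => 0 < b)%N beta ->
     forall m : seq nat,
       Zc alpha [seq (a + delta)%N | a <- alpha] m =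
         ((#|{perm 'I_(ntz alpha)}|%:R : rat)^-1) *:
           \sum_(s : {perm 'I_(ntz alpha)}) Zc alpha (permtail alpha beta s) m,
   (* (3) *)
   (0 < last 0%N alpha)%N ->
     forall (s : nat) (beta : seq nat),
       size beta = size alpha -> all (fun b => 0 < b)%N beta ->
     forall m : seq nat,
       Zc (alpha ++ nseq s 0%N) (beta ++ nseq s delta) m =
       Zc (alpha ++ nseq s 0%N) (nseq (size alpha + s) delta) m
   &
   (* (4) *)
   forall m : seq nat,
     Zc alpha [seq (a + delta)%N | a <- alpha] m = Zc alpha (nseq (size alpha) delta) m].
Proof.
move=> alpha0 delta0.
have last01 : (0 < last 0%N alpha)%N -> (0 < last 1 alpha)%N by case: (alpha) alpha0.
have ne c : alpha ++ c <> [::] by case: (alpha) alpha0.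
have dp n : all (fun x => 0 < x)%N (nseq n delta) by rewrite all_nseq delta0 orbT.
have adp (a : seq nat) : all (fun x => 0 < x)%N [seq (x + delta)%N | x <- a].
  by apply/allP => _ /mapP[x _ ->]; rewrite addn_gt0 delta0 orbT.
have [a E al] := ntz_split alpha.
set n := ntz alpha in E *.
have sa : (size a + n = size alpha)%N by rewrite E size_cat size_nseq.
have Zalpha b c m : size b = size a -> size c = n -> all (fun x => 0 < x)%N b ->
    all (fun x => 0 < x)%N c -> Zc alpha (b ++ c) m =
    \sum_(i <- prefixes a m) pshiftp (last 0%N i) (Zw (zeroword c) [::]).
  move=> sb sc bp cp; rewrite [in LHS]E -sc Zc_cat // => /(congr1 size).
  by rewrite size_cat sc sa => /size0nil; rewrite -[alpha]cats0; apply: ne.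
(* Under the trailing zeros of alpha, the row alpha + delta is constantly delta. *)
have mapE : [seq (x + delta)%N | x <- alpha] = [seq (x + delta)%N | x <- a] ++ nseq n delta.
  by rewrite [in LHS]E map_cat map_nseq.
split.
- move=> /last01 la m.
  have := @Zc_cat alpha [seq (x + delta)%N | x <- alpha] [::] m la.
  rewrite size_map !cats0 => -> //; last by rewrite -[alpha]cats0; apply: ne.
  (* The zero part is empty with value 1, so the sum counts prefixes, which is [Mcoef]. *)
  rewrite /Zw /phip /= /xone /= /lcoef0 /=.
  rewrite (eq_bigr (fun=> 1)); last by move=> i _; rewrite /pshiftp comp_polyC.
  by rewrite big_const_seq count_predT iter_addr_0 size_filter polyCMn.
- move=> _ beta sb bp m.
  rewrite mapE Zalpha ?size_map ?size_nseq //.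
  set b1 := take (size alpha - n) beta.
  have sb1 : size b1 = size a by rewrite size_takel ?sb -sa ?addnK // leq_addr.
  have b1p : all (fun x => 0 < x)%N b1 by apply/allP => x /mem_take; apply: (allP bp).
  have nthp k : (k < size beta)%N -> (0 < nth 0%N beta k)%N by move=> kb; apply: (all_nthP 0%N bp).
  rewrite (eq_bigr (fun s : 'S_n => \sum_(i <- prefixes a m) pshiftp (last 0%N i)
     (Zw (zeroword [seq nth 0%N beta (size alpha - n + s j) | j <- enum 'I_n]) [::]))); last first.
    move=> s _; rewrite Zalpha //; first by rewrite size_map; exact: size_enum_ord.
    apply/allP => _ /mapP[j _ ->]; apply: nthp; rewrite sb -sa addnK ltn_add2l; exact: ltn_ord.
  rewrite exchange_big scaler_sumr /=; apply: eq_bigr => i _.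
  rewrite pshiftp_sum /pshiftp -comp_polyZ; congr (_ \Po _).
  rewrite (@perm_sumE _ n (fun k => nth 0%N beta (size alpha - n + k))
     (fun x => Zw (zeroword x) [::])).
  rewrite symsum_Zw ?size_map ?size_iota; last first.
    apply/allP => _ /mapP[k + ->]; rewrite mem_iota => /andP[_ kn].
    by apply: nthp; rewrite sb -sa addnK ltn_add2l.
  (* For the constant word all n! rearrangements coincide, so [symZ n] is also n! times the value at
     delta^n. *)
  have := @perm_sumE _ n (fun=> delta) (fun x => Zw (zeroword x) [::]).
  rewrite symsum_Zw ?size_map ?size_iota; last first.
    by apply/allP => _ /mapP[k _ ->].
  rewrite (eq_bigr (fun=> Zw (zeroword (nseq n delta)) [::])); last first.
    move=> s _; congr (Zw (zeroword _) _).
    by rewrite -[in RHS](size_enum_ord n); elim: (enum _) => //= k l ->.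
  rewrite sumr_const => <-.
  rewrite -scaler_nat scalerA mulVf ?scale1r // pnatr_eq0 card_Sn -lt0n fact_gt0.
  by [].
- move=> /last01 la s beta sb bp m.
  rewrite -{1 3}(size_nseq s delta) nseqD !Zc_cat ?size_nseq //.
(* Both rows end in delta^n under the trailing zeros, and [Zalpha] sees nothing else of them. *)
- move=> m; rewrite mapE -sa nseqD !Zalpha ?size_map ?size_nseq //.
Qed.
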